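(* For every integer $k\ge1$, every finite graph $G$ has a good tree-decomposition that includes among its parts all those $k$-blocks of $G$ that are a part in some tree-decomposition of $G$ of adhesion $<k$.
   Context: A $k$-block of $G$ is a maximal set $X$ of at least $k$ vertices such that no two vertices $x,x'\in X$ can be separated in $G$ by fewer than $k$ vertices other than $x$ and $x'$. For a tree-decomposition $(T,(V_t)_{t\in T})$ of $G$, the sets $V_t$ are its parts and the sets $V_t\cap V_{t'}$ with $tt'\in E(T)$ are its adhesion sets; it has adhesion $<k$ if all adhesion sets have size $<k$. It is canonical if it is obtained by an assignment of tree-decompositions to graphs that commutes with graph isomorphisms; for a single graph $G$ this means invariance under automorphisms: for every automorphism $\alpha$ of $G$ there is an automorphism $\varphi$ of $T$ with $\alpha(V_t)=V_{\varphi(t)}$ for all $t\in T$. Given $k$, a tree-decomposition of $G$ is good if it is canonical, has adhesion $<k$, and distinguishes all the $k$-blocks of $G$ efficiently, i.e. any two distinct $k$-blocks are separated by an adhesion set of the tree-decomposition (they lie in parts on different sides of the corresponding tree edge) whose size is minimum among all the separators in $G$ between those two blocks. *)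

(* Defs.v *)
From mathcomp Require Import all_boot perm.

Set Implicit Arguments.
Unset Strict Implicit.
Unset Printing Implicit Defensive.

Record sgraph := SGraph {
  vertex :> finType;
  adj : rel vertex;
  adj_sym : symmetric adj;
  adj_irrefl : irreflexive adj
}.

Section Graph.
Variable G : sgraph.

(* Paths of G - S; [connect (adj_minus S)] is meant to be used between
   vertices outside S only. *)
Definition adj_minus (S : {set G}) : rel G :=
  [rel u v | [&& adj u v, u \notin S & v \notin S]].

(* Every A-B path of G meets S; S may intersect A and B. *)
Definition separates (S A B : {set G}) : bool :=
  [forall a in A :\: S, forall b in B :\: S, ~~ connect (adj_minus S) a b].

Definition inseparable (k : nat) (X : {set G}) : bool :=
  [forall x in X, forall y in X, (x != y) ==>
    [forall S : {set G},
      [&& #|S| < k, x \notin S & y \notin S] ==>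
        ~~ separates S [set x] [set y]]].

Definition kblock (k : nat) (X : {set G}) : bool :=
  maxset [pred Y : {set G} | (k <= #|Y|) && inseparable k Y] X.

Definition automorphism (f : {perm G}) : Prop :=
  forall x y : G, adj (f x) (f y) = adj x y.

(* The one- and two-element sequences are excluded: [:: x; y] is a cycle in
   the sense of [ucycle] as soon as xy is an edge. *)
Definition is_tree : Prop :=
  [/\ 0 < #|G|,
      forall x y : G, connect (@adj G) x y
    & forall c : seq G, ucycle (@adj G) c -> size c < 3].

Definition adj_del_edge (t t' : G) : rel G :=
  [rel u v | adj u v && ([set u; v] != [set t; t'])].

(* In a tree with edge tt': the component of G - tt' containing t. *)
Definition side (t t' : G) : {set G} :=
  [set s | connect (adj_del_edge t t') t s].

End Graph.

Section TreeDecomposition.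
Variables (G T : sgraph) (V : T -> {set G}).

Definition tree_decomposition : Prop :=
  [/\ is_tree T,
      forall x : G, exists t : T, x \in V t,
      forall x y : G, adj x y -> exists t : T, (x \in V t) && (y \in V t)
    & forall (t1 t2 : T) (p : seq T),
        path (@adj T) t1 p -> uniq (t1 :: p) -> t2 \in t1 :: p ->
        V t1 :&: V (last t1 p) \subset V t2].

Definition adhesion_lt (k : nat) : Prop :=
  forall t t' : T, adj t t' -> #|V t :&: V t'| < k.

Definition is_part (X : {set G}) : Prop := exists t : T, V t = X.

Definition canonical : Prop :=
  forall a : {perm G}, automorphism a ->
  exists2 f : {perm T}, automorphism f & forall t : T, a @: V t = V (f t).

Definition edge_separates (t t' : T) (X Y : {set G}) : Prop :=
  separates (V t :&: V t') X Y /\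
  exists s s' : T,
    [/\ s \in side t t', s' \in side t' t, X \subset V s & Y \subset V s'].

Definition distinguishes_efficiently (k : nat) : Prop :=
  forall X Y : {set G}, kblock k X -> kblock k Y -> X != Y ->
  exists t t' : T,
    [/\ adj t t',
        edge_separates t t' X Y
      & forall S : {set G}, separates S X Y -> #|V t :&: V t'| <= #|S|].

Definition good (k : nat) : Prop :=
  [/\ tree_decomposition, canonical, adhesion_lt k
    & distinguishes_efficiently k].

End TreeDecomposition.

(* Main.v *)
Require Import Defs.
From mathcomp Require Import all_boot perm.

Set Implicit Arguments.
Unset Strict Implicit.
Unset Printing Implicit Defensive.

(** Separations are pairs (A, B) ordered by A ⊆ C, B ⊇ D.  For each pair of
    k-blocks take, among the separations distinguishing it efficiently, those
    crossing as few efficient separations as possible.  If two of these crossed,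
    submodularity would make two opposite corners efficient again, and corners
    have in total fewer crossings: so the chosen separations are nested, and the
    choice is invariant under automorphisms.

    A k-block X that is a part in some tree-decomposition of adhesion < k is
    "isolable": every component C of G - X has fewer than k neighbours.  Let
    (A, B) be a maximal chosen separation with X ⊆ B.  It efficiently
    distinguishes X from another block, and hence its separator A ∩ B lies in
    C ∪ N(C) for a single component C whenever A ∩ B is not contained in X.
    Absorbing A \ B into that C for all such (A, B) gives separations with
    separator N(C), nested with everything chosen before, which cut X off from
    all remaining vertices.

    The nodes of the tree are the orientations of the resulting nested set, the
    part at an orientation being the intersection of the sides pointed to. *)

(** * Separations and crossing numbers *)

Section Separations.
Variable V : finType.
Local Notation sep := ({set V} * {set V})%type.
Implicit Types (s r u : sep) (X Y : {set V}).

Definition swap s : sep := (s.2, s.1).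
Definition sle s r := (s.1 \subset r.1) && (r.2 \subset s.2).
Definition nested s r :=
  [|| sle s r, sle s (swap r), sle (swap s) r | sle (swap s) (swap r)].
(** One corner of [s] and [r]; the opposite corner is [meet (swap s) (swap r)]. *)
Definition meet s r : sep := (s.1 :&: r.1, s.2 :|: r.2).
Definition ord s := #|s.1 :&: s.2|.

Lemma swapK : involutive swap. Proof. by case. Qed.

Lemma sle_refl s : sle s s. Proof. by rewrite /sle !subxx. Qed.

Lemma sle_trans : transitive sle.
Proof.
move=> s r u /andP[a b] /andP[c d]; apply/andP; split.
  exact: subset_trans a c.
exact: subset_trans d b.
Qed.

Lemma sle_anti s r : sle s r -> sle r s -> s = r.
Proof.
case: s r => [A B] [C D] /andP[/= a b] /andP[/= c d].
by congr (_, _); apply/eqP; rewrite eqEsubset ?a ?b ?c ?d.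
Qed.

Lemma sle_swap s r : sle (swap s) (swap r) = sle r s.
Proof. by rewrite /sle andbC. Qed.

Lemma sle_swapl s r : sle (swap s) r = sle (swap r) s.
Proof. by rewrite -sle_swap swapK. Qed.

Lemma sle_swapr s r : sle s (swap r) = sle r (swap s).
Proof. by rewrite -sle_swap swapK. Qed.

Lemma nested_sym s r : nested s r = nested r s.
Proof.
rewrite /nested !sle_swap (sle_swapl s) (sle_swapr s).
by case: (sle s r); case: (sle r s); case: (sle r (swap s)); case: (sle _ _).
Qed.

Lemma nested_swapr s r : nested s (swap r) = nested s r.
Proof.
rewrite /nested !swapK.
by case: (sle s r); case: (sle s (swap r)); case: (sle (swap s) r);
  case: (sle (swap s) (swap r)).
Qed.

Lemma nested_swapl s r : nested (swap s) r = nested s r.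
Proof. by rewrite nested_sym nested_swapr nested_sym. Qed.

Lemma ord_swap s : ord (swap s) = ord s.
Proof. by rewrite /ord setIC. Qed.

(** Submodularity, with equality: the two corner separators have the same union and the same
    intersection as the separators of [s] and [r]. *)
Lemma ord_corners s r : s.1 :|: s.2 = setT -> r.1 :|: r.2 = setT ->
  ord (meet s r) + ord (meet (swap s) (swap r)) = ord s + ord r.
Proof.
move=> Hs Hr; rewrite /ord -cardsUI -[RHS]cardsUI.
by congr addn; apply: eq_card => x; move/setP/(_ x): Hs; move/setP/(_ x): Hr;
  rewrite !inE /=; case: (x \in s.1); case: (x \in s.2); case: (x \in r.1);
  case: (x \in r.2).
Qed.

Lemma meetC s r : meet s r = meet r s.
Proof. by rewrite /meet setIC setUC. Qed.

Lemma meet_lel s r : sle (meet s r) s.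
Proof. by rewrite /sle subsetIl subsetUl. Qed.

Lemma meet_ler s r : sle (meet s r) r.
Proof. by rewrite /sle subsetIr subsetUr. Qed.

Lemma sle_meet u s r : sle u s -> sle u r -> sle u (meet s r).
Proof.
by move=> /andP[a b] /andP[c d]; rewrite /sle /= subsetI a c subUset b d.
Qed.

(** After swapping [u] if necessary, [u] is below [s] or [swap s]. If [swap u] were below an
    orientation of [r], transitivity through [u] would nest [s] with [r]; so [u] is below [r] or
    [swap r] as well. Below [swap s] or [swap r] it is below the swapped corner, otherwise below the
    corner itself. *)
Lemma nested_corner u s r : ~~ nested s r -> nested u s -> nested u r ->
  nested u (meet s r).
Proof.
move=> ncr.
wlog uP : u / sle u s || sle u (swap s).
  move=> W us ur; have [h|] := boolP (sle u s || sle u (swap s)); first exact: W.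
  rewrite negb_or => /andP[/negPf a /negPf b].
  rewrite -nested_swapl; apply: W; rewrite ?nested_swapl //.
  by move: us; rewrite /nested a b.
move=> _ ur.
have {ur} urP : sle u r || sle u (swap r).
  case/or4P: ur => [->|->|h|h]; rewrite ?orbT //; exfalso; move/negP: ncr; apply;
    rewrite sle_swapl ?swapK in h; case/orP: uP => k;
    have hk := sle_trans h k; rewrite /nested.
  - by rewrite sle_swapl hk !orbT.
  - by rewrite -(sle_swap r) hk.
  - by rewrite sle_swap hk !orbT.
  - by rewrite sle_swapr hk orbT.
case/orP: uP => h1; last first.
  by rewrite -nested_swapr /nested (sle_trans h1) // sle_swap meet_lel.
case/orP: urP => h2; last first.
  by rewrite -nested_swapr /nested (sle_trans h2) // sle_swap meet_ler.
by rewrite /nested sle_meet.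
Qed.

(** An orientation of [u] below [s] is below the swap of [meet (swap s) (swap r)]; one below
    [swap s] is below the swap of [meet s r]. *)
Lemma nested_corner1 u s r : nested u s ->
  nested u (meet s r) || nested u (meet (swap s) (swap r)).
Proof.
wlog uP : u / sle u s || sle u (swap s).
  move=> W us; have [h|] := boolP (sle u s || sle u (swap s)); first exact: W.
  rewrite negb_or => /andP[/negPf a /negPf b].
  rewrite -!(nested_swapl u); apply: W; rewrite ?nested_swapl //.
  by move: us; rewrite /nested a b.
move=> _; case/orP: uP => h; apply/orP.
  right; rewrite -nested_swapr /nested (sle_trans h) //.
  by rewrite -[X in sle X]swapK sle_swap meet_lel.
by left; rewrite -nested_swapr /nested (sle_trans h) // sle_swap meet_lel.
Qed.

Definition crossings (E : {set sep}) s := #|[set r in E | ~~ nested r s]|.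

Lemma crossings_swap E s : crossings E (swap s) = crossings E s.
Proof. by apply: eq_card => r; rewrite !inE nested_swapr. Qed.

(** Whatever crosses a corner crosses [s] or [r], and whatever crosses both corners crosses both.
    Strictness comes from [s] itself, which crosses [r] but is nested with both corners. *)
Lemma crossings_corners (E : {set sep}) s r : s \in E -> ~~ nested s r ->
  crossings E (meet s r) + crossings E (meet (swap s) (swap r)) <
    crossings E s + crossings E r.
Proof.
move=> sE ncr.
set c1 := meet s r; set c2 := meet (swap s) (swap r).
pose K t := [set u in E | ~~ nested u t].
have nc2 : ~~ nested (swap s) (swap r) by rewrite nested_swapr nested_swapl.
have nsc1 : nested s c1 by rewrite nested_sym /nested meet_lel.
have nsc2 : nested s c2.
  by rewrite nested_sym -nested_swapr /nested meet_lel.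
have sub1 : K c1 :|: K c2 \subset (K s :|: K r) .
  apply/subsetP=> u; rewrite !inE -!andb_orr => /andP[-> /=].
  apply: contraLR; rewrite negb_or !negbK => /andP[us ur].
  by rewrite !nested_corner // ?nested_swapr.
have sub2 : K c1 :&: K c2 \subset K s :&: K r.
  apply/subsetP=> u; rewrite !inE => /andP[/andP[-> n1] /andP[_ n2]] /=.
  apply/andP; split.
    by apply/negP=> /(nested_corner1 r); rewrite (negPf n1) (negPf n2).
  rewrite /c1 /c2 meetC in n1; rewrite /c2 meetC in n2.
  by apply/negP=> /(nested_corner1 s); rewrite (negPf n1) (negPf n2).
rewrite /crossings -/(K c1) -/(K c2) -/(K s) -/(K r) -cardsUI -[X in _ < X]cardsUI.
have sKr : s \in K s :|: K r by rewrite !inE sE ncr orbT.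
have sub1' : K c1 :|: K c2 \subset (K s :|: K r) :\ s.
  apply/subsetP=> u uc; rewrite !inE; apply/andP; split; last first.
    by have := subsetP sub1 _ uc; rewrite !inE.
  by apply: contraTneq uc => ->; rewrite !inE nsc1 nsc2 !andbF.
rewrite (cardsD1 s (K s :|: K r)) sKr add1n addSn ltnS leq_add ?subset_leq_card //.
Qed.

End Separations.

(** * The tree of a nested set of separations *)

Section NestedTree.
Variables (V : finType) (N : {set {set V} * {set V}}).
Local Notation sep := ({set V} * {set V})%type.
Implicit Types (s r : sep) (O P : {set sep}).

(** [s \in O] is read as pointing from [s.1] towards [s.2]; downward closure is the usual
    consistency. *)
Definition orientation O :=
  [&& O \subset N, [forall s in N, (s \in O) != (swap s \in O)]
    & [forall s in N, [forall r in O, sle s r ==> (s \in O)]]].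

(* The only orientation with s as a maximal element. *)
Definition up s := [set r in N | sle r s || sle r (swap s) && (r != swap s)].

(** The set [F] records which separations may be flipped, so that a walk can be shown to avoid the
    edge of a given separation. *)
Definition step (F : {set sep}) : rel {set sep} :=
  fun O P => [exists s in F, (O == up s) && (P == up (swap s))].

Hypothesis N_swap : forall s, s \in N -> swap s \in N.
Hypothesis N_nested : forall s r, s \in N -> r \in N -> nested s r.
Hypothesis N_regular : forall s, s \in N -> ~~ sle s (swap s).

Lemma N_swapE s : (swap s \in N) = (s \in N).
Proof. by apply/idP/idP => [/N_swap|/N_swap]; rewrite ?swapK. Qed.

Lemma orientationP O : reflect
  [/\ {subset O <= N}, forall s, s \in N -> (swap s \in O) = (s \notin O)
    & forall s r, s \in N -> r \in O -> sle s r -> s \in O] (orientation O).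
Proof.
apply: (iffP and3P) => [[/subsetP a /forall_inP b /forall_inP c]|[a b c]].
  split=> // [s sN|s r sN rO sr]; first by have := b s sN; case: (s \in O);
    case: (_ \in O).
  by have /forall_inP/(_ r rO) := c s sN; rewrite sr.
split; first exact/subsetP.
  by apply/forall_inP=> s /b ->; case: (s \in O).
by apply/forall_inP=> s sN; apply/forall_inP=> r rO; apply/implyP; apply: c.
Qed.

Lemma up_self s : s \in N -> s \in up s.
Proof. by move=> sN; rewrite inE sN sle_refl. Qed.

Lemma up_swap_self s : s \in N -> s \notin up (swap s).
Proof. by move=> sN; rewrite inE sN (negPf (N_regular sN)) swapK eqxx andbF. Qed.

Lemma up_swap s r : s \in N ->
  (r \in up (swap s)) = (r == swap s) || (r \in up s) && (r != s).
Proof.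
move=> sN; rewrite !inE swapK; have [->|ris] := eqVneq r (swap s).
  by rewrite N_swapE sN sle_refl.
case: (r \in N) => //=; have [->|rs] := eqVneq r s.
  by rewrite sle_refl !andbF (negPf (N_regular sN)).
by rewrite !andbT orbC.
Qed.

(** For [r] other than [s] and [swap s], nestedness puts [r] or [swap r] below [s] or [swap s]. Both
    at once would violate regularity by transitivity, or identify [r] with [s] or [swap s] by
    antisymmetry. *)
Lemma up_orientation s : s \in N -> orientation (up s).
Proof.
move=> sN; apply/orientationP; split=> [r|r rN|r t rN]; first by rewrite inE => /andP[].
  have swap_reg u : u \in N -> sle (swap u) u = false.
    by move=> uN; have := N_regular (N_swap uN); rewrite swapK => /negPf.
  have reg u : u \in N -> sle u (swap u) = false by move/N_regular/negPf.
  rewrite !inE N_swapE rN /= sle_swap (inj_eq (can_inj (@swapK V))).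
  have [->|rs] := eqVneq r s; first by rewrite sle_refl swap_reg ?andbF.
  have [->|ris] := eqVneq r (swap s).
    by rewrite swapK !sle_refl swap_reg.
  rewrite !andbT; case/or4P: (N_nested rN sN) => h.
  - rewrite h /=; apply/negP=> /orP[k|k]; last by rewrite (sle_anti h k) eqxx in rs.
    by have := swap_reg _ sN; rewrite (sle_trans _ h) // sle_swapl.
  - rewrite h orbT /=; rewrite sle_swapl; apply/negP=> /orP[k|k].
      by rewrite (sle_anti h k) eqxx in ris.
    by have := reg _ sN; rewrite (sle_trans k h).
  - rewrite h /=; apply/esym/negP; rewrite sle_swapl in h => /orP[k|k].
      by have := swap_reg _ sN; rewrite (sle_trans h k).
    by rewrite (sle_anti k h) eqxx in ris.
  - rewrite sle_swap in h; rewrite h orbT; apply/esym/negP=> /orP[] k.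
      by rewrite (sle_anti h k) eqxx in rs.
    by have := reg _ sN; rewrite (sle_trans h k).
rewrite !inE rN => /andP[tN /orP[ts|/andP[ts tis]]] rt /=;
  first by rewrite (sle_trans rt ts).
rewrite (sle_trans rt ts) /=; apply/orP; right.
by apply: contraNneq tis => e; rewrite (sle_anti ts) // -e.
Qed.

(** An element of [O] below neither [s] nor [swap s] would have [s] below it, against maximality, or
    [swap s] below it, which would put [swap s] into [O] next to [s]. *)
Lemma orientation_up O s : orientation O -> s \in O ->
  (forall r, r \in O -> sle s r -> r = s) -> O = up s.
Proof.
case/orientationP=> ON Oswap Odown sO smax; have sN := ON _ sO.
apply/setP=> r; rewrite inE; case rN: (r \in N); last by apply/negbTE;
  apply: contraFN rN => /ON.
rewrite /=; apply/idP/idP => [rO|/orP[|/andP[]]]; last 2 first.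
- exact: Odown.
- move=> ris rnis; rewrite -[r \in O]negbK -Oswap //; apply: contra rnis => riO.
  by rewrite -[r]swapK (smax _ riO) // -sle_swapr.
have [//|nrs] := boolP (sle r s); rewrite /=.
have rnis : r != swap s by apply: contraTneq rO => ->; rewrite Oswap // sO.
rewrite rnis andbT; case/or4P: (N_nested rN sN) => // h; first by rewrite h in nrs.
  rewrite sle_swapl in h.
  have : swap s \in O by apply: (Odown _ r); rewrite ?N_swapE.
  by rewrite Oswap ?sO.
by rewrite sle_swap in h; rewrite (smax _ rO h) sle_refl in nrs.
Qed.

Lemma exists_orientation : exists O, orientation O.
Proof.
have [N0|[s sN]] := set_0Vmem N; last by exists (up s); exact: up_orientation.
by exists set0; apply/and3P; split; rewrite ?sub0set //;
  apply/forall_inP=> s; rewrite N0 inE.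
Qed.

Lemma step_mono (F F' : {set sep}) : F \subset F' -> subrel (step F) (step F').
Proof.
by move=> /subsetP sF O P /exists_inP[s /sF sF' e]; apply/exists_inP; exists s.
Qed.

Lemma exists_maximal (F : {set sep}) s : s \in F ->
  exists2 r, r \in F /\ sle s r & forall t, t \in F -> sle r t -> t = r.
Proof.
elim: {F}_.+1 {-2}F (ltnSn #|F|) s => // n IH F Fn s sF.
have [/exists_inP[t tF /andP[st ts]]|] := boolP [exists t in F, sle s t && (t != s)].
  have [||r [rF tr] rmax] := IH (F :\ s) _ t.
  - by rewrite (cardsD1 s) sF in Fn.
  - by rewrite !inE ts.
  move: rF; rewrite !inE => /andP[rs rF].
  exists r; first by rewrite (sle_trans st tr).
  move=> u uF ru; apply: rmax => //; rewrite !inE uF andbT.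
  apply: contraNneq ts => us; rewrite us in ru.
  by rewrite (sle_anti (sle_trans tr ru) st).
rewrite negb_exists_in => /forall_inP smax.
exists s; first by rewrite sle_refl.
by move=> t tF st; apply/eqP; have := smax t tF; rewrite st negbK.
Qed.

(** A maximal bad element [r] of [O] is maximal in [O], because badness passes upwards; hence
    [O = up r], and flipping [r] leads to a neighbouring orientation with fewer bad elements. Only
    separations that were bad in [O] get flipped. *)
Lemma walk (bad : pred sep) O : orientation O ->
  (forall s r, s \in N -> r \in N -> sle s r -> bad s -> bad r) ->
  (forall s, s \in N -> bad s -> ~~ bad (swap s)) ->
  exists P, [/\ orientation P, forall s, s \in P -> ~~ bad s
    & connect (step [set s in O | bad s]) O P].
Proof.
move=> oO bad_up bad_swap.
elim: {O}_.+1 {-2}O (ltnSn #|[set s in O | bad s]|) oO => // n IH O On oO.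
have /orientationP[ON Oswap Odown] := oO.
have [F0|[s sF]] := set_0Vmem [set s in O | bad s].
  exists O; split=> // s sO; apply/negP=> bs.
  by have := in_set0 s; rewrite -F0 inE sO bs.
have [r [rF sr] rmax] := exists_maximal sF.
move: (rF); rewrite inE => /andP[rO br]; have rN := ON _ rO.
have eO : O = up r.
  apply: orientation_up => // t tO rt; apply: rmax => //.
  by rewrite inE tO (bad_up r) // ON.
have sub : [set s in up (swap r) | bad s] \subset [set s in O | bad s] :\ r.
  apply/subsetP=> t; rewrite in_set in_setD1 inE up_swap // => /andP[/orP[/eqP->|]].
    by rewrite (negPf (bad_swap _ rN br)).
  by rewrite eO => /andP[-> ->] ->.
have [||P [oP Pb OP]] := IH (up (swap r)).
- apply: leq_ltn_trans (subset_leq_card sub) _.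
  by rewrite (cardsD1 r) rF in On.
- by apply: up_orientation; apply: N_swap.
exists P; split=> //; apply: connect_trans (connect1 _) (connect_sub _ OP).
  by apply/exists_inP; exists r => //; rewrite {1}eO !eqxx.
move=> x y xy; apply: connect1; apply: step_mono xy.
by apply: subset_trans sub _; rewrite subD1set.
Qed.

Definition node : finType := {O : {set sep} | orientation O}.

Definition node_adj : rel node := fun t t' => step N (val t) (val t').

Lemma node_adj_sym : symmetric node_adj.
Proof.
suff sym t t' : node_adj t t' -> node_adj t' t by move=> t t'; apply/idP/idP;
  exact: sym.
case/exists_inP=> s sN /andP[a b]; apply/exists_inP; exists (swap s);
  rewrite ?N_swapE //.
by rewrite swapK a b.
Qed.

Lemma node_adj_irrefl : irreflexive node_adj.
Proof.
move=> t; apply/negbTE/exists_inP => -[s sN /andP[/eqP a /eqP b]].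
by have := up_self sN; rewrite -a b (negPf (up_swap_self sN)).
Qed.

Definition nested_tree : sgraph := SGraph node_adj_sym node_adj_irrefl.
Implicit Types t : nested_tree.

Lemma adj_cross t t' s : s \in N -> adj t t' -> s \notin val t -> s \in val t' ->
  val t = up (swap s) /\ val t' = up s.
Proof.
move=> sN /exists_inP[r rN /andP[/eqP -> /eqP ->]].
rewrite up_swap // => sr; rewrite (negPf sr) orbF => /eqP->.
by rewrite swapK.
Qed.

(** Each separation labels a single edge of the tree, so a path whose ends orient [s] differently
    runs along that edge. *)
Lemma path_cross t p s : s \in N -> path (@adj nested_tree) t p ->
  s \notin val t -> s \in val (last t p) ->
  exists t1 t2 p1 p2, [/\ p = p1 ++ t2 :: p2, last t p1 = t1,
    val t1 = up (swap s) & val t2 = up s].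
Proof.
move=> sN; elim: p t => [|t' p IH] t /=; first by move=> _ /negPf->.
move=> /andP[tt' pt'] st sl.
have [st'|st'] := boolP (s \in val t').
  have [a b] := adj_cross sN tt' st st'.
  by exists t, t', [::], p.
have [t1 [t2 [p1 [p2 [-> a b c]]]]] := IH _ pt' st' sl.
by exists t1, t2, (t' :: p1), p2.
Qed.

Lemma connect_nodes (F : {set sep}) t t' : F \subset N ->
  connect (step F) (val t) (val t') ->
  connect [rel u v : nested_tree | step F (val u) (val v)] t t'.
Proof.
move=> FN /connectP[p]; elim: p t => [|O p IH] t /=.
  by move=> _ /val_inj->; exact: connect0.
move=> /andP[tO pO] e.
have oO : orientation O.
  by case/exists_inP: tO => s /(subsetP FN) sN /andP[_ /eqP->];
    rewrite up_orientation ?N_swap.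
apply: connect_trans (connect1 _) (IH (Sub O oO) _ _); by rewrite ?SubK.
Qed.

(** This is [walk] with bad meaning absent from [val t']. It stops at an orientation contained in
    [val t'], hence equal to it. *)
Lemma walk_to t t' :
  connect [rel u v : nested_tree | step (val t :\: val t') (val u) (val v)] t t'.
Proof.
have /orientationP[tN ti td] := valP t; have /orientationP[tN' ti' td'] := valP t'.
have [||P [oP Pb tP]] := @walk [pred s | s \notin val t'] (val t) (valP t).
- by move=> s r sN rN sr /=; apply: contra => rt'; exact: td' sr.
- by move=> s sN /= st'; rewrite negbK ti'.
have eP : P = val t'.
  have /orientationP[PN Pi Pd] := oP.
  apply/eqP; rewrite eqEsubset; apply/andP; split; apply/subsetP=> s; first by move/Pb;
    rewrite negbK.
  move=> st'; rewrite -[_ \in _]negbK -Pi ?tN' //; apply/negP=> /Pb;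
    rewrite negbK ti' ?tN' //.
  by rewrite st'.
rewrite eP in tP; apply: connect_nodes.
  by apply/subsetP=> s; rewrite inE => /andP[_ /tN].
have -> // : val t :\: val t' = [set s in val t | [pred s | s \notin val t'] s].
by apply/setP=> s; rewrite !inE andbC.
Qed.

Lemma nested_tree_is_tree : is_tree nested_tree.
Proof.
split.
- by have [O oO] := exists_orientation; apply/card_gt0P; exists (Sub O oO).
- move=> t t'; apply: connect_sub (walk_to t t') => u v uv; apply: connect1.
  apply: step_mono uv; apply/subsetP=> s; rewrite inE => /andP[_].
  by have /orientationP[tN _ _] := valP t; apply: tN.
(* The first edge of the cycle flips some [s]. The rest leads from [y] back to [x], so it must run
   along the same edge from [y] to [x]; then [x] or [y] is repeated. *)
- case=> [|x [|y [|z c]]] //= /andP[cyc un]; exfalso.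
  move: cyc; rewrite /cycle /= -[adj y z && _]/(path (@adj nested_tree) y (rcons (z ::
    c) x)).
  case/andP=> xy pyx; have /exists_inP[s sN /andP[/eqP ex /eqP ey]] := xy.
  have sx : s \in val (last y (rcons (z :: c) x)) by rewrite last_rcons ex up_self.
  have sy : s \notin val y by rewrite ey up_swap_self.
  have [t1 [t2 [p1 [p2 [e e1 e2 e3]]]]] := path_cross sN pyx sy sx.
  have t1y : t1 = y by apply: val_inj; rewrite e2.
  have t2x : t2 = x by apply: val_inj; rewrite e3.
  rewrite t2x in e; rewrite t1y in e1 => {t1 t2 e2 e3 t1y t2x}.
  have ux : uniq (y :: rcons (z :: c) x).
    by rewrite -rcons_cons rcons_uniq.
  rewrite e -cat_cons cat_uniq in ux; case/and3P: ux => u1 u2 _.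
  case: p1 e e1 u1 {u2} => [[zx _]|a p1 _ /= e1].
    by move: un; rewrite /= zx !inE eqxx orbT.
  by rewrite -{1}e1 mem_last.
Qed.

(** * Parts and adhesion sets of the tree *)

Definition part t : {set V} := \bigcap_(s in val t) s.2.

Lemma partP x t : reflect (forall s, s \in val t -> x \in s.2) (x \in part t).
Proof. exact: bigcapP. Qed.

(** If [x] is in both end parts but outside [s.2] for some [s] in [val t2], then [s] belongs to
    neither end. So the path uses the edge of [s] before and after [t2] and visits the node
    [up (swap s)] twice. *)
Lemma part_path t1 t2 (p : seq nested_tree) : path (@adj nested_tree) t1 p ->
  uniq (t1 :: p) -> t2 \in t1 :: p -> part t1 :&: part (last t1 p) \subset part t2.
Proof.
move=> pth un t2p; apply/subsetP=> x /setIP[x1 x3]; apply/partP=> s st2.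
have sN : s \in N by have /orientationP[h _ _] := valP t2; apply: h.
apply/negPn/negP=> xs.
have s1 : s \notin val t1 by apply: contra xs => h; exact: (partP _ _ x1).
have s3 : s \notin val (last t1 p) by apply: contra xs => h; exact: (partP _ _ x3).
move: t2p; rewrite inE => /orP[/eqP e|t2p]; first by rewrite e (negPf s1) in st2.
case/path.splitP: t2p pth un s3 => q1 q2.
rewrite cat_path last_cat last_rcons -cat_cons cat_uniq =>
  /andP[pq1 pq2] /and3P[_ /hasPn q12 _] s3.
have [|a1 [a2 [p1 [p2 [e e1 e2 _]]]]] := path_cross sN pq1 s1;
  first by rewrite last_rcons.
have a1q : a1 \in t1 :: rcons q1 t2 by rewrite e -cat_cons mem_cat -e1 mem_last.
have [||b1 [b2 [p3 [p4 [f _ _ f2]]]]] := path_cross (N_swap sN) pq2.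
- by have /orientationP[_ h _] := valP t2; rewrite h // st2.
- by have /orientationP[_ h _] := valP (last t2 q2); rewrite h.
have /q12 /negP[] : b2 \in q2 by rewrite f mem_cat inE eqxx orbT.
by rewrite (_ : b2 = a1) //; apply: val_inj; rewrite e2 f2.
Qed.

(** Every element of the two orientations is below [s] or [swap s], so its second side contains
    [s.2] or [s.1]; the elements [s] and [swap s] themselves cut the intersection down to the
    separator. *)
Lemma part_adj t t' s : s \in N -> val t = up s -> val t' = up (swap s) ->
  s.1 :|: s.2 = setT -> part t :&: part t' = s.1 :&: s.2.
Proof.
move=> sN et et' cov; apply/setP=> x; rewrite !inE.
apply/andP/andP => [[/partP xt /partP xt']|[x1 x2]].
  split; first by apply: (xt' (swap s)); rewrite et' up_self ?N_swap.
  by apply: xt; rewrite et up_self.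
have key r : sle r s || sle r (swap s) -> x \in r.2.
  by case/orP=> /andP[_ /subsetP h]; apply: h.
split; apply/partP=> r.
  by rewrite et inE => /andP[_ h]; apply: key; case/orP: h => [->|/andP[->]] //;
    rewrite orbT.
rewrite et' inE swapK => /andP[_ h]; apply: key; rewrite orbC.
by case/orP: h => [->|/andP[->]] //; rewrite orbT.
Qed.

(** This is [walk] with bad meaning that [K] is not inside the second side; it serves for vertices
    and for edges. *)
Lemma exists_part (K : {set V}) :
  (forall s, s \in N -> (K \subset s.1) || (K \subset s.2)) ->
  exists t, K \subset part t.
Proof.
move=> hK; have [O oO] := exists_orientation.
have [||P [oP Pb _]] := @walk [pred s : sep | ~~ (K \subset s.2)] O oO.
- move=> s r _ _ /andP[_ rs] /=; apply: contra => h; exact: subset_trans h rs.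
- by move=> s sN /= h; rewrite negbK; have := hK s sN; rewrite (negPf h) orbF.
exists (Sub P oP); apply/bigcapsP=> s; rewrite SubK => /Pb /=; by rewrite negbK.
Qed.

(** The walk from [t] to [t''] flips only separations missing from [val t''], hence never [s],
    whereas the edge between [t] and [t'] flips [s]. *)
Lemma mem_side t t' t'' s : s \in N -> val t = up s -> val t' = up (swap s) ->
  s \in val t'' -> t'' \in side t t'.
Proof.
move=> sN et et' st''; rewrite inE.
have := walk_to t t''; apply: connect_sub => u v /= /exists_inP[r].
rewrite inE => /andP[rt'' rt] /andP[/eqP eu' /eqP ev'].
have eu : val u = up r := eu'; have ev : val v = up (swap r) := ev'.
have /orientationP[tN ti _] := valP t.
have rN : r \in N := tN _ rt.
apply: connect1 => /=; apply/andP; split.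
  by apply/exists_inP; exists r => //; apply/andP; split; apply/eqP.
have st : s \in val t by rewrite et up_self.
have st' : s \notin val t' by rewrite et' up_swap_self.
have suv : (s \in val u) = (s \in val v).
  have nsr : (s == swap r) = false.
    by apply/negP=> /eqP e; have := ti r rN; rewrite -e rt st.
  have sr : s != r by apply: contraNneq rt'' => <-.
  by rewrite ev up_swap // -eu nsr sr andbT.
apply/negP=> /eqP e.
have : t \in [set u; v] by rewrite e !inE eqxx.
have : t' \in [set u; v] by rewrite e !inE eqxx orbT.
have sv : s \in val v.
  have : t \in [set u; v] by rewrite e !inE eqxx.
  by case/set2P=> k; [rewrite -suv -k|rewrite -k].
by case/set2P=> k; move: st'; rewrite k ?suv sv.
Qed.

End NestedTree.

(** * Invariance of the tree *)

Section Action.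
Variables (V : finType) (a : {perm V}).
Local Notation sep := ({set V} * {set V})%type.
Implicit Types (s r : sep) (A B : {set V}).

Definition image_sep s : sep := (a @: s.1, a @: s.2).

Lemma image_subset A B : (a @: A \subset a @: B) = (A \subset B).
Proof.
apply/idP/idP => [|h]; last exact: imsetS.
move=> /subsetP h; apply/subsetP=> x xA.
by have := h _ (imset_f a xA); rewrite mem_imset //; exact: perm_inj.
Qed.

Lemma image_sep_inj : injective image_sep.
Proof.
by case=> A B [C D] [] /(imset_inj (@perm_inj _ a)) -> /(imset_inj (@perm_inj _ a)) ->.
Qed.

Lemma image_sle s r : sle (image_sep s) (image_sep r) = sle s r.
Proof. by rewrite /sle !image_subset. Qed.

Lemma image_swap s : image_sep (swap s) = swap (image_sep s).
Proof. by []. Qed.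

Lemma image_nested s r : nested (image_sep s) (image_sep r) = nested s r.
Proof. by rewrite /nested -!image_swap !image_sle. Qed.

Lemma image_ord s : ord (image_sep s) = ord s.
Proof.
by rewrite /ord -imsetI ?card_imset //; [exact: perm_inj|move=> x y _ _;
  exact: perm_inj].
Qed.

Section InvariantSet.
Variable N : {set sep}.
Hypothesis N_swap : forall s, s \in N -> swap s \in N.
Hypothesis N_regular : forall s, s \in N -> ~~ sle s (swap s).
Hypothesis N_image : forall s, s \in N -> image_sep s \in N.

Lemma image_set : image_sep @: N = N.
Proof.
apply/eqP; rewrite eqEcard card_imset ?leqnn ?andbT; last exact: image_sep_inj.
by apply/subsetP=> _ /imsetP[s sN ->]; apply: N_image.
Qed.

Lemma image_sep_mem s : (image_sep s \in N) = (s \in N).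
Proof. by rewrite -{1}image_set mem_imset //; exact: image_sep_inj. Qed.

Lemma image_up s : up N (image_sep s) = image_sep @: up N s.
Proof.
apply/setP=> r; apply/idP/imsetP => [|[t tu ->]]; last first.
  by move: tu; rewrite !inE image_sep_mem -image_swap !image_sle (inj_eq image_sep_inj).
rewrite inE => /andP[rN]; rewrite -image_set in rN; case/imsetP: rN => t tN -> h.
exists t => //; rewrite inE tN /=.
by move: h; rewrite -image_swap !image_sle (inj_eq image_sep_inj).
Qed.

Lemma image_orientation (O : {set sep}) : orientation N O ->
  orientation N (image_sep @: O).
Proof.
have mi := mem_imset _ _ image_sep_inj.
case/orientationP=> ON Oi Od; apply/orientationP; split.
- by move=> _ /imsetP[s sO ->]; rewrite image_sep_mem ON.
- move=> s; rewrite -{1}image_set => /imsetP[t tN ->].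
  by rewrite -image_swap !mi Oi.
- move=> s r; rewrite -{1}image_set => /imsetP[t tN ->] /imsetP[u uO ->].
  rewrite image_sle mi; exact: Od.
Qed.

Local Notation T := (nested_tree N_swap N_regular).

Definition image_node (t : T) : T := Sub _ (image_orientation (valP t)).

Lemma image_node_inj : injective image_node.
Proof.
move=> t u /(congr1 val); rewrite !SubK => /(imset_inj image_sep_inj) e.
exact: val_inj.
Qed.

Lemma canonical_nested_tree : exists2 f : {perm T},
  automorphism f & forall t, a @: part t = part (f t).
Proof.
exists (perm image_node_inj) => [t u|t].
  rewrite !permE; apply/exists_inP/exists_inP => -[s sN /andP[/eqP e1 /eqP e2]].
    rewrite -image_set in sN; case/imsetP: sN => r rN e.
    have i1 := imset_inj image_sep_inj.
    exists r => //; apply/andP; split; apply/eqP; apply: i1.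
      by rewrite -image_up -e -e1.
    by rewrite -image_up image_swap -e -e2.
  exists (image_sep s); first exact: N_image.
  by rewrite !SubK -image_swap !image_up e1 e2 !eqxx.
rewrite permE; apply/setP=> x;
  apply/imsetP/partP => [[y /partP yt ->] _ /imsetP[s st ->]|h].
  by rewrite mem_imset; [exact: yt|exact: perm_inj].
exists ((a^-1)%g x); last by rewrite permKV.
apply/partP=> s st.
have := h (image_sep s) (imset_f _ st).
by rewrite -{1}[x](permKV a) mem_imset //; exact: perm_inj.
Qed.

End InvariantSet.
End Action.

(** * Efficient separations of blocks *)

Section Blocks.
Variables (G : sgraph) (k : nat).
Local Notation sep := ({set G} * {set G})%type.
Implicit Types (s r : sep) (X Y S : {set G}).

Definition separation s :=
  (s.1 :|: s.2 == setT) && [forall u in s.1 :\: s.2, forall v in s.2 :\: s.1,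
    ~~ adj u v].

Lemma separationP s : reflect
  [/\ s.1 :|: s.2 = setT, forall x, x \notin s.1 -> x \in s.2
    & forall u v, u \notin s.2 -> v \notin s.1 -> ~~ adj u v] (separation s).
Proof.
apply: (iffP andP) => [[/eqP c /forall_inP h]|[c _ h]].
  have cov x : x \notin s.1 -> x \in s.2.
    by move/setP/(_ x): c; rewrite !inE => + /negPf xs; rewrite xs.
  have cov' x : x \notin s.2 -> x \in s.1 by apply: contraNT => /cov.
  split=> // u v us vs; have uD : u \in s.1 :\: s.2 by rewrite inE us cov'.
  by apply: (forall_inP (h u uD)); rewrite inE vs cov.
split; first exact/eqP.
by apply/forall_inP=> u /setDP[_ us]; apply/forall_inP=> v /setDP[_ vs]; exact: h.
Qed.

Lemma separation_swap s : separation s -> separation (swap s).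
Proof.
case/separationP=> c c2 h; apply/separationP; split; first by rewrite setUC.
  by move=> x /=; apply: contraNT => /c2.
by move=> u v us vs; rewrite adj_sym h.
Qed.

Lemma separation_meet s r : separation s -> separation r -> separation (meet s r).
Proof.
case/separationP=> _ c h /separationP[_ c' h'].
apply/separationP; split => [|x|u v] /=.
- apply/setP=> x; rewrite !inE; move: (c x) (c' x).
  by case: (x \in s.1); case: (x \in r.1) => //= a b; rewrite ?(a isT) ?(b isT) ?orbT.
- by rewrite !inE negb_and => /orP[/c->|/c'->]; rewrite ?orbT.
- by rewrite !inE negb_or negb_and => /andP[a b] /orP[]; [exact: h|exact: h'].
Qed.

Lemma connect_crossing s x y : separation s -> x \notin s.2 -> y \notin s.1 ->
  ~~ connect (adj_minus (s.1 :&: s.2)) x y.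
Proof.
case/separationP=> _ c h xs ys; apply/negP=> /connectP[p pth e].
elim: p x xs pth e => [|z p IH] x xs /=.
  by move=> _ e; rewrite e in ys; rewrite c // in xs; rewrite -e.
case/andP=> /and3P[xz _ zS] pz e.
apply: (IH z) => //; apply: contra zS => zs2; rewrite inE zs2 andbT.
by apply: contraLR xz; exact: h.
Qed.

Lemma separation_separates s X Y : separation s -> X \subset s.1 -> Y \subset s.2 ->
  separates (s.1 :&: s.2) X Y.
Proof.
move=> hs /subsetP Xs /subsetP Ys.
apply/forall_inP=> x /setDP[/Xs xs1 xS]; apply/forall_inP=> y /setDP[/Ys ys2 yS].
by apply: connect_crossing => //; move: xS yS; rewrite !inE ?xs1 ?ys2 ?andbT.
Qed.

Lemma adj_minus_sym S : connect_sym (adj_minus S).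
Proof. by apply: sym_connect_sym => x y; rewrite /adj_minus /= (adj_sym x);
  congr (_ && _); exact: andbC. Qed.

Lemma separates_separation S X Y : separates S X Y ->
  exists s, [/\ separation s, s.1 :&: s.2 = S, X \subset s.1 & Y \subset s.2].
Proof.
move=> /forall_inP sep.
(* [R] is what can be reached from [X] outside [S]; together with [S] it forms the side of [X]. *)
pose R := [set v in ~: S | [exists x in X :\: S, connect (adj_minus S) x v]].
exists (S :|: R, ~: R); split=> /=.
- apply/separationP; split=> /= [|x|u v].
  + by apply/setP=> x; rewrite !inE orbC; case: (_ && _); rewrite ?orbT.
  + by rewrite in_setU in_setC negb_or => /andP[].
  + rewrite in_setC negbK in_setU negb_or !inE =>
    /andP[uS /exists_inP[x xX xu]] /andP[vS].
    rewrite vS /= negb_exists_in => /forall_inP/(_ x xX); apply: contra => uv.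
    by apply: connect_trans xu (connect1 _); apply/and3P.
- by apply/setP=> x; rewrite !inE; case: (x \in S); rewrite ?orbF //= andbN.
- apply/subsetP=> x xX; rewrite !inE; case xS: (x \in S) => //=.
  by apply/exists_inP; exists x; rewrite ?connect0 // !inE xS.
- apply/subsetP=> y yY; rewrite !inE negb_and negbK; case yS: (y \in S) => //=.
  rewrite negb_exists_in; apply/forall_inP=> x xX.
  by have /forall_inP := sep x xX; apply; rewrite inE yS.
Qed.

Lemma kblockP X : kblock k X ->
  [/\ k <= #|X|, inseparable k X
    & forall Y, k <= #|Y| -> inseparable k Y -> X \subset Y -> Y = X].
Proof.
case/maxsetP=> /andP[a b] h; split=> // Y c d XY.
by apply: h => //=; rewrite c.
Qed.

Lemma inseparable_side X s : inseparable k X -> separation s -> ord s < k ->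
  (X \subset s.1) || (X \subset s.2).
Proof.
move=> ins hs os; apply: contraTT ins;
  rewrite negb_or => /andP[/subsetPn[y yX y1] /subsetPn[x xX x2]].
have [_ c _] := separationP _ hs.
have xy : x != y by apply: contraNneq x2 => ->; exact: c.
rewrite /inseparable negb_forall; apply/existsP; exists x; rewrite negb_imply xX.
rewrite negb_forall; apply/existsP; exists y; rewrite negb_imply yX.
rewrite negb_imply xy negb_forall; apply/existsP; exists (s.1 :&: s.2).
rewrite negb_imply os !inE (negPf x2) (negPf y1) andbF /= negbK.
apply: separation_separates; rewrite // sub1set; last exact: c.
by apply: contraNT x2 => /c.
Qed.

(** A block inside both sides would lie in the separator, which is too small for it. *)
Lemma block_side X s : kblock k X -> separation s -> ord s < k ->
  (X \subset s.2) = ~~ (X \subset s.1).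
Proof.
case/kblockP=> Xk ins _ hs os; have := inseparable_side ins hs os.
case h1: (X \subset s.1) => //= _; apply/negbTE/negP => h2.
by move: os; rewrite ltnNge (leq_trans Xk) // subset_leq_card // subsetI h1.
Qed.

Lemma block_nsubset X Y : kblock k X -> kblock k Y -> X != Y -> ~~ (X \subset Y).
Proof.
move=> /kblockP[_ _ hX] /kblockP[Yk Yi _]; apply: contraNN => /hX -> //.
Qed.

(** By maximality the union of the two blocks is not inseparable, so fewer than [k] vertices
    separate some [x] from some [y] in it. Each block lies on one side of the resulting separation;
    a common side would contain both [x] and [y]. *)
Lemma blocks_separation X Y : kblock k X -> kblock k Y -> X != Y ->
  exists s, [/\ separation s, X \subset s.1, Y \subset s.2 & ord s < k].
Proof.
move=> hX hY XY; have [Xk Xi Xm] := kblockP hX; have [Yk Yi Ym] := kblockP hY.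
have : ~~ inseparable k (X :|: Y).
  apply/negP=> iXY; have kXY : k <= #|X :|: Y| by apply: leq_trans Xk (subset_leq_card
    (subsetUl _ _)).
  by rewrite -(Xm _ kXY iXY (subsetUl _ _)) (Ym _ kXY iXY (subsetUr _ _)) eqxx in XY.
rewrite /inseparable negb_forall => /existsP[x]; rewrite negb_imply => /andP[xXY].
rewrite negb_forall => /existsP[y]; rewrite negb_imply => /andP[yXY].
rewrite negb_imply => /andP[xy]; rewrite negb_forall => /existsP[S].
rewrite negb_imply negbK =>
  /andP[/and3P[Sk xS yS] /separates_separation[s [hs eS xs ys]]].
have os : ord s < k by rewrite /ord eS.
rewrite !sub1set in xs ys.
have xs2 : x \notin s.2 by move: xS; rewrite -eS inE xs.
have ys1 : y \notin s.1 by move: yS; rewrite -eS inE ys andbT.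
have := block_side hX hs os; have := block_side hY hs os.
case Y1: (Y \subset s.1) => /= Y2; case X1: (X \subset s.1) => /= X2.
- by move: yXY; rewrite inE => /orP[/(subsetP X1)|/(subsetP Y1)] h; rewrite h in ys1.
- by exists (swap s); rewrite ord_swap; split=> //; apply: separation_swap.
- by exists s.
- by move: xXY; rewrite inE => /orP[/(subsetP X2)|/(subsetP Y2)] h; rewrite h in xs2.
Qed.

(** * Efficient and optimal separations of two blocks *)

Definition efficient X Y s :=
  [&& separation s, X \subset s.1, Y \subset s.2
    & [forall S, separates S X Y ==> (ord s <= #|S|)]].

Lemma efficientP X Y s : reflect
  [/\ separation s, X \subset s.1, Y \subset s.2
    & forall r, separation r -> X \subset r.1 -> Y \subset r.2 -> ord s <= ord r]
  (efficient X Y s).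
Proof.
apply: (iffP and4P) => -[a b c d]; split=> //.
  move=> r hr Xr Yr; have /implyP := forallP d (r.1 :&: r.2); apply.
  exact: separation_separates.
apply/forallP=> S; apply/implyP=> /separates_separation[r [hr <- Xr Yr]].
exact: d.
Qed.

Lemma efficient_swap X Y s : efficient X Y s -> efficient Y X (swap s).
Proof.
case/efficientP=> a b c d; apply/efficientP; split=> //; first exact: separation_swap.
move=> r hr Yr Xr; rewrite ord_swap -(ord_swap r); apply: d => //;
  exact: separation_swap.
Qed.

Lemma efficient_exists X Y s : separation s -> X \subset s.1 -> Y \subset s.2 ->
  exists r, efficient X Y r.
Proof.
move=> hs Xs Ys; pose P r := [&& separation r, X \subset r.1 & Y \subset r.2].
have Ps : P s by apply/and3P.
case: (arg_minnP (@ord _) Ps) => r /and3P[hr Xr Yr] rmin.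
by exists r; apply/efficientP; split=> // t ht Xt Yt; apply: rmin; apply/and3P.
Qed.

Definition distinguishers : {set sep} :=
  [set s | [exists X, exists Y,
    [&& kblock k X, kblock k Y, X != Y & efficient X Y s]]].

(** All minimisers are kept: breaking ties would destroy invariance under automorphisms. *)
Definition optimal X Y s := efficient X Y s &&
  [forall r, efficient X Y r ==>
    (crossings distinguishers s <= crossings distinguishers r)].

Definition block_seps : {set sep} :=
  [set s | [exists X, exists Y,
    [&& kblock k X, kblock k Y, X != Y & optimal X Y s]]].

Lemma efficient_ord X Y s : kblock k X -> kblock k Y -> X != Y ->
  efficient X Y s -> ord s < k.
Proof.
move=> hX hY XY /efficientP[_ _ _ h].
have [r [hr Xr Yr]] := blocks_separation hX hY XY; apply: leq_ltn_trans.
exact: h.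
Qed.

Lemma block_sepsP s : reflect
  (exists X Y, [/\ kblock k X, kblock k Y, X != Y & optimal X Y s]) (s \in block_seps).
Proof.
rewrite inE; apply: (iffP existsP) => -[X].
  by case/existsP=> Y /and4P[]; exists X, Y.
by case=> Y [a b c d]; exists X; apply/existsP; exists Y; apply/and4P.
Qed.

Lemma mem_distinguishers X Y s : kblock k X -> kblock k Y -> X != Y ->
  efficient X Y s -> s \in distinguishers.
Proof.
move=> a b c d; rewrite inE; apply/existsP; exists X; apply/existsP; exists Y.
exact/and4P.
Qed.

Lemma optimal_exists X Y : kblock k X -> kblock k Y -> X != Y ->
  exists s, optimal X Y s.
Proof.
move=> hX hY XY; have [r [hr Xr Yr _]] := blocks_separation hX hY XY.
have [s es] := efficient_exists hr Xr Yr.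
case: (arg_minnP (crossings distinguishers) es) => t et tmin.
by exists t; rewrite /optimal et; apply/forall_inP.
Qed.

Lemma optimal_swap X Y s : optimal X Y s -> optimal Y X (swap s).
Proof.
case/andP=> e /forall_inP m; rewrite /optimal efficient_swap //.
apply/forall_inP=> r /efficient_swap/m.
by rewrite !crossings_swap.
Qed.

Lemma block_seps_swap s : s \in block_seps -> swap s \in block_seps.
Proof.
case/block_sepsP=> X [Y [a b c d]]; apply/block_sepsP; exists Y, X.
by rewrite eq_sym optimal_swap.
Qed.

Lemma optimal_sep X Y s : optimal X Y s -> separation s.
Proof. by case/andP=> /efficientP[]. Qed.

(* Each corner is again efficient for one of the two pairs, hence crosses at
   least as many separations as r, resp. s, against crossings_corners. *)
Lemma opposite_corners P Q P' Q' s r :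
  kblock k P -> kblock k Q -> P != Q -> kblock k P' -> kblock k Q' -> P' != Q' ->
  optimal P Q s -> optimal P' Q' r -> ~~ nested s r ->
  P' \subset s.1 :&: r.1 -> Q \subset s.2 :&: r.2 -> False.
Proof.
move=> hP hQ PQ hP' hQ' PQ' os or ncr P'c Qc.
have /andP[es /forall_inP ms] := os; have /andP[er /forall_inP mr] := or.
have /efficientP[seps Ps Qs effs] := es; have /efficientP[sepr Pr Qr effr] := er.
set c := meet s r; set d := meet (swap s) (swap r).
have sepc : separation c by apply: separation_meet.
have sepd : separation d by apply: separation_meet; apply: separation_swap.
have Q'c : Q' \subset c.2 by apply: subset_trans Qr (subsetUr _ _).
have Pd : P \subset (swap d).1 by apply: subset_trans Ps (subsetUl _ _).
have le1 : ord r <= ord c by apply: effr.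
have le2 : ord s <= ord (swap d) by apply: effs => //; exact: separation_swap.
have [covs _ _] := separationP _ seps; have [covr _ _] := separationP _ sepr.
(* Each corner has at least the order of the separation it competes with, and the sums agree, so
   both bounds are attained. *)
have eqo := ord_corners covs covr; rewrite -/c -/d in eqo; rewrite ord_swap in le2.
have cr : ord c = ord r.
  apply/eqP; rewrite eqn_leq le1 andbT -(leq_add2r (ord d)) eqo addnC leq_add2l //.
have ds : ord d = ord s by move: eqo; rewrite cr addnC => /addIn.
have ec : efficient P' Q' c by apply/efficientP; split=> // t; rewrite cr; apply: effr.
have ed : efficient P Q (swap d).
  apply/efficientP; split=> //; first exact: separation_swap.
  by move=> t; rewrite ord_swap ds; apply: effs.
have sD : s \in distinguishers by apply: mem_distinguishers es.
have ltx := crossings_corners sD ncr; rewrite -/c -/d in ltx.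
have xs := ms _ ed; rewrite crossings_swap in xs.
by have := leq_trans ltx (leq_add xs (mr _ ec)); rewrite addnC ltnn.
Qed.

(** Both opposite corners separate the same pair [P], [Q], and their orders sum to at most twice
    [ord r]. So both are efficient and each has at least as many crossings as [r];
    [crossings_corners] then leaves [r] strictly below [s]. *)
Lemma common_pair_crossings P Q s r :
  s \in distinguishers -> separation s -> ord s <= ord r -> optimal P Q r ->
  ~~ nested s r -> P \subset s.1 :&: r.1 -> Q \subset s.2 :&: r.2 ->
  crossings distinguishers r < crossings distinguishers s.
Proof.
move=> sD seps sr /andP[/efficientP[sepr Pr Qr effr] /forall_inP mr] ncr Pc Qc.
set c := meet s r; set d := swap (meet (swap s) (swap r)).
have sepc : separation c by apply: separation_meet.
have sepd : separation d by apply/separation_swap/separation_meet;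
  apply: separation_swap.
have Qc2 : Q \subset c.2 by apply: subset_trans Qr (subsetUr _ _).
have Pd1 : P \subset d.1 by apply: subset_trans Pr (subsetUr _ _).
have le1 : ord r <= ord c by apply: effr.
have le2 : ord r <= ord d by apply: effr.
have [covs _ _] := separationP _ seps; have [covr _ _] := separationP _ sepr.
have eqo := ord_corners covs covr;
  rewrite -/c -[ord (meet (swap s) _)]ord_swap -/d in eqo.
have le3 : ord c + ord d <= ord r + ord r by rewrite eqo leq_add2r.
have cr : ord c <= ord r by rewrite -(leq_add2r (ord d)) (leq_trans le3) ?leq_add2l.
have dr : ord d <= ord r by rewrite -(leq_add2l (ord c)) (leq_trans le3) ?leq_add2r.
have ec : efficient P Q c.
  by apply/efficientP; split=> // t a b e; apply: leq_trans cr _; apply: effr.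
have ed : efficient P Q d.
  by apply/efficientP; split=> // t a b e; apply: leq_trans dr _; apply: effr.
have ltx := crossings_corners sD ncr;
  rewrite -/c -[crossings _ (meet (swap s) _)]crossings_swap -/d in ltx.
have := leq_ltn_trans (leq_add (mr _ ec) (mr _ ed)) ltx.
by rewrite ltn_add2r.
Qed.

(* If neither pair of opposite corners is excluded by opposite_corners, then one
   pair shows that r has fewer crossings than s, and the other the reverse. *)
Lemma crossing_pair P Q P' Q' s r :
  kblock k P -> kblock k Q -> P != Q -> kblock k P' -> kblock k Q' -> P' != Q' ->
  optimal P Q s -> optimal P' Q' r -> ~~ nested s r ->
  P' \subset s.1 -> Q' \subset s.2 -> False.
Proof.
move=> hP hQ PQ hP' hQ' PQ' os or ncr P's Q's.
have /andP[es _] := os; have /efficientP[seps Ps Qs effs] := es.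
have /andP[er _] := or; have /efficientP[sepr Pr Qr effr] := er.
have ordr := efficient_ord hP' hQ' PQ' er.
have hPr := block_side hP sepr ordr; have hQr := block_side hQ sepr ordr.
have Q'P' : Q' != P' by rewrite eq_sym.
have QP : Q != P by rewrite eq_sym.
case Q2: (Q \subset r.2).
  by apply: (opposite_corners hP hQ PQ hP' hQ' PQ' os or); rewrite // subsetI ?P's ?Qs.
case P1: (P \subset r.1).
  apply: (opposite_corners hQ hP QP hQ' hP' Q'P' (optimal_swap os) (optimal_swap or)).
  - by rewrite nested_swapl nested_swapr.
  - by rewrite subsetI Q's.
  - by rewrite subsetI Ps.
have Q1 : Q \subset r.1 by move: hQr; rewrite Q2; case: (Q \subset r.1).
have P2 : P \subset r.2 by rewrite hPr P1.
(* It remains that [swap r] separates [P] from [Q] while [s] separates [P'] from [Q']; hence the two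
   orders agree. *)
have sr : ord s <= ord r.
  by rewrite -(ord_swap r); apply: effs => //; exact: separation_swap.
have rs : ord r <= ord s by apply: effr.
have lt1 : crossings distinguishers r < crossings distinguishers s.
  apply: (common_pair_crossings (mem_distinguishers hP hQ PQ es) seps sr or ncr).
    by rewrite subsetI P's.
  by rewrite subsetI Q's.
have lt2 : crossings distinguishers s < crossings distinguishers (swap r).
  apply: (@common_pair_crossings P Q) => //.
  - exact: mem_distinguishers (efficient_swap er).
  - exact: separation_swap.
  - by rewrite ord_swap.
  - by rewrite nested_swapl nested_sym.
  - by rewrite subsetI P2.
  - by rewrite subsetI Q1.
by have := ltn_trans lt1 lt2; rewrite crossings_swap ltnn.
Qed.

Lemma block_seps_nested s r : s \in block_seps -> r \in block_seps -> nested s r.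
Proof.
case/block_sepsP=> P [Q [hP hQ PQ os]] /block_sepsP[P' [Q' [hP' hQ' PQ' or]]].
apply/negPn/negP => ncr.
have /andP[es _] := os; have /efficientP[seps Ps Qs _] := es.
have /andP[er _] := or; have /efficientP[sepr Pr Qr _] := er.
have ords := efficient_ord hP hQ PQ es; have ordr := efficient_ord hP' hQ' PQ' er.
have Q'P' : Q' != P' by rewrite eq_sym.
have QP : Q != P by rewrite eq_sym.
have os' := optimal_swap os; have or' := optimal_swap or.
have n1 : ~~ nested (swap s) r by rewrite nested_swapl.
have n2 : ~~ nested s (swap r) by rewrite nested_swapr.
have n3 : ~~ nested (swap s) (swap r) by rewrite nested_swapl.
have hPr := block_side hP sepr ordr; have hQr := block_side hQ sepr ordr.
have := block_side hP' seps ords; have := block_side hQ' seps ords.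
case P's: (P' \subset s.1); case Q's: (Q' \subset s.1) => /= Q's2 P's2.
(* Both blocks of [r] lie with [P] in [s.1]. Whichever side of [r] contains [Q], the other contains
   one of [P'], [Q']; that block and [Q] are then in opposite corners. *)
- case Q1: (Q \subset r.1).
    by apply: (opposite_corners hP hQ PQ hQ' hP' Q'P' os or');
      rewrite // subsetI ?Q's ?Qs.
  by apply: (opposite_corners hP hQ PQ hP' hQ' PQ' os or);
    rewrite // subsetI ?P's ?Qs // hQr Q1.
- exact: crossing_pair hP hQ PQ hP' hQ' PQ' os or ncr P's Q's2.
- exact: crossing_pair hP hQ PQ hQ' hP' Q'P' os or' n2 Q's P's2.
- case P1: (P \subset r.1).
    by apply: (opposite_corners hQ hP QP hQ' hP' Q'P' os' or');
      rewrite // subsetI ?Q's2 ?Ps.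
  by apply: (opposite_corners hQ hP QP hP' hQ' PQ' os' or);
    rewrite // subsetI ?P's2 ?Ps // hPr P1.
Qed.

End Blocks.

(** * Isolating blocks *)

Section Isolation.
Variables (G : sgraph) (k : nat).
Local Notation sep := ({set G} * {set G})%type.
Implicit Types (s r : sep) (X Y C : {set G}).
Local Notation N0 := (block_seps G k).

Definition component X v : {set G} := [set u | connect (adj_minus X) v u].
Definition nbhd X C : {set G} := [set x in X | [exists u in C, adj u x]].

Definition towards X : {set sep} := [set s in N0 | X \subset s.2].

Definition maximal_towards X : {set sep} :=
  [set s in towards X | [forall r in towards X, sle s r ==> (r == s)]].

Definition branch X C : {set G} :=
  C :|: \bigcup_(s in maximal_towards X | s.1 :&: s.2 :&: C != set0) (s.1 :\: s.2).

Definition isolating X C : sep := (branch X C :|: nbhd X C, ~: branch X C).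

Definition isolable X := [forall v, (v \notin X) ==> (#|nbhd X (component X v)| < k)].

(** The vertices that the chosen block separations fail to cut off from [X]; only their components
    receive an isolating separation. *)
Definition central X v := (v \notin X) && [forall s in towards X, v \in s.2].

Definition isolators : {set sep} :=
  [set s | [exists X, exists v, [&& kblock k X, isolable X, central X v &
     (s == isolating X (component X v)) || (s == swap (isolating X (component X v)))]]].

Lemma comp_self X v : v \in component X v.
Proof. by rewrite inE connect0. Qed.

Lemma comp_out X v u : v \notin X -> u \in component X v -> u \notin X.
Proof.
rewrite inE => vX /connectP[p].
elim: p v vX => [|w p IH] v vX /=; first by move=> _ ->.
by case/andP=> /and3P[_ _ wX] pw; apply: IH.
Qed.

Lemma comp_step X v u w : v \notin X -> u \in component X v -> adj u w -> w \notin X ->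
  w \in component X v.
Proof.
move=> vX uC uw wX; have uX := comp_out vX uC; move: uC; rewrite !inE => uC.
by apply: connect_trans uC (connect1 _); apply/and3P.
Qed.

Lemma comp_eq X v w u : u \in component X v -> u \in component X w ->
  component X v = component X w.
Proof.
rewrite !inE => uv uw; apply/setP=> x; rewrite !inE.
have sym := adj_minus_sym X.
by rewrite (same_connect sym uv) (same_connect sym uw).
Qed.

Lemma nbhd_sub X C : nbhd X C \subset X.
Proof. by apply/subsetP=> x; rewrite inE => /andP[]. Qed.

Lemma comp_separation X v : v \notin X ->
  separation (component X v :|: nbhd X (component X v), ~: component X v).
Proof.
move=> vX; apply/separationP; split=> /= [|x|u w].
- by apply/setP=> x; rewrite in_setU in_setC in_setU in_setT;
  case: (x \in component X v); rewrite ?orbT.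
- by rewrite in_setU negb_or in_setC => /andP[].
rewrite in_setC negbK in_setU negb_or => uC /andP[wC wn]; apply/negP=> uw.
have wX : w \in X by apply: contraNT wC; exact: comp_step uC uw.
by move: wn; rewrite inE wX /= => /exists_inP[]; exists u.
Qed.

(** The component is connected and misses the separator, so it cannot change sides. *)
Lemma comp_avoid X v s w u : separation s -> v \notin X ->
  s.1 :&: s.2 :&: component X v = set0 -> w \in component X v -> w \in s.2 ->
  u \in component X v -> u \notin s.1.
Proof.
case/separationP=> _ cov h vX dis wC ws uC.
have disj x : x \in component X v -> x \in s.1 -> x \in s.2 -> False.
  by move=> a b c; have := in_set0 x; rewrite -dis !inE b c /=; rewrite inE in a;
    rewrite a.
pose a := [pred x | (x \in component X v) && (x \notin s.1)].
have cl : closed (adj_minus X) a.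
  apply: intro_closed; first exact: adj_minus_sym.
  move=> x y xy /andP[xC xs]; have /and3P[axy _ yX] := xy.
  have yC := comp_step vX xC axy yX.
  apply/andP; split=> //; apply/negP=> ys1.
  have ys2 : y \notin s.2 by apply/negP => ys2; exact: disj ys2.
  by have := h y x ys2 xs; rewrite adj_sym axy.
have wu : connect (adj_minus X) w u.
  move: wC uC; rewrite !inE => wC uC; apply: connect_trans uC.
  by rewrite adj_minus_sym.
have : w \in a by apply/andP; split=> //; apply/negP=> ws1; exact: disj ws.
by rewrite (closed_connect cl wu) => /andP[].
Qed.

Lemma isolableP X : reflect (forall v, v \notin X ->
  #|nbhd X (component X v)| < k) (isolable X).
Proof.
by apply: (iffP forallP) => h v; [have /implyP := h v|apply/implyP; apply: h].
Qed.

Lemma block_sep_sep s : s \in N0 -> separation s.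
Proof. by case/block_sepsP=> P [Q [_ _ _ /optimal_sep]]. Qed.

Lemma block_sep_ord s : s \in N0 -> ord s < k.
Proof. by case/block_sepsP=> P [Q [hP hQ PQ /andP[/(efficient_ord hP hQ PQ)]]]. Qed.

Lemma block_sep_side X s : kblock k X -> s \in N0 ->
  (X \subset s.2) = ~~ (X \subset s.1).
Proof. by move=> hX sN; rewrite (block_side hX) ?block_sep_sep ?block_sep_ord. Qed.

Lemma block_sep_regular s : s \in N0 -> ~~ sle s (swap s).
Proof.
move=> sN; have /block_sepsP[P [Q [hP hQ PQ /andP[/efficientP[_ Ps _ _] _]]]] := sN.
apply/negP=> /andP[s12 _]; have := block_sep_side hP sN.
by rewrite Ps (subset_trans Ps s12).
Qed.

Lemma towards_not_fst X s : kblock k X -> s \in towards X -> ~~ (X \subset s.1).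
Proof. by move=> hX; rewrite inE => /andP[sN Xs]; rewrite -block_sep_side. Qed.

Lemma towards_max X s : s \in towards X -> exists2 r, r \in maximal_towards X & sle s r.
Proof.
move=> /exists_maximal[r [rt sr] rmax]; exists r => //.
rewrite inE rt; apply/forall_inP=> t tt; apply/implyP=> rt'.
by rewrite (rmax t tt rt').
Qed.

Lemma maximal_towardsP X s : s \in maximal_towards X ->
  [/\ s \in N0, X \subset s.2, s \in towards X
    & forall r, r \in towards X -> sle s r -> r = s].
Proof.
case/setIdP=> st /forall_inP h; case/setIdP: (st) => sN Xs.
by split=> // r rt sr; apply/eqP; have := h r rt; rewrite sr.
Qed.

(** If [s] is optimal for [P], [Q], take [r] optimal for [P], [X]. If [s] is below [r], maximality
    gives [r = s]. If [r] is below [s], then [r] also separates [P] from [Q], so [ord s] is at most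
    [ord r] and [s] is efficient for [P], [X]. The other two ways of being nested put [P] or [X] on
    both sides of [r]. *)
Lemma maximal_efficient X s : kblock k X -> s \in maximal_towards X ->
  exists Y, [/\ kblock k Y, Y != X & efficient Y X s].
Proof.
move=> hX /maximal_towardsP[sN Xs st smax].
have /block_sepsP[P [Q [hP hQ PQ os]]] := sN.
have /andP[/efficientP[seps Ps Qs effs] _] := os.
have PX : P != X by apply: contraTneq Ps => ->; exact: towards_not_fst.
have [r or] := optimal_exists hP hX PX.
have /andP[/efficientP[sepr Pr Xr effr] _] := or.
have rN : r \in N0 by apply/block_sepsP; exists P, X.
have rt : r \in towards X by rewrite inE rN.
have hPr := block_sep_side hP rN; rewrite Pr /= in hPr.
exists P; split=> //; case/or4P: (block_seps_nested sN rN) => h.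
- by rewrite -(smax _ rt h); have /andP[] := or.
- by case/andP: h => h _; rewrite (subset_trans Ps h) in hPr.
- case/andP: h => h _; have := towards_not_fst hX rt.
  by rewrite (subset_trans Xs h).
- rewrite sle_swap in h; case/andP: h => _ s2r2.
  have sr : ord s <= ord r by apply: effs => //; apply: subset_trans Qs s2r2.
  apply/efficientP; split=> // t a b c; apply: leq_trans sr _; exact: effr.
Qed.

(* If w lies in Y but not in X, then the part of the separator inside
   component X w and its neighbourhood still separates Y from X, because that
   neighbourhood is contained in X; efficiency forces it to be everything. *)
Lemma efficient_separator X Y s v : kblock k X -> isolable X -> kblock k Y -> Y != X ->
  efficient Y X s -> v \notin X -> s.1 :&: s.2 :&: component X v != set0 ->
  s.1 :&: s.2 \subset component X v :|: nbhd X (component X v).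
Proof.
move=> hX /isolableP iX hY YX /efficientP[seps Ys Xs eff] vX /set0Pn[x].
rewrite inE => /andP[xs xv].
have /subsetPn[w wY wX] := block_nsubset hY hX YX.
set c := (component X w :|: nbhd X (component X w), ~: component X w) : sep.
have sepc : separation c by apply: comp_separation.
have nC z : z \in nbhd X (component X w) -> z \notin component X w.
  by move/(subsetP (nbhd_sub _ _)) => zX; apply: contraL zX; exact: comp_out.
have cint : c.1 :&: c.2 = nbhd X (component X w).
  apply/setP=> z; rewrite in_setI in_setU in_setC; case zn: (z \in nbhd _ _).
    by rewrite orbT nC.
  by rewrite orbF andbN.
have Yc : Y \subset c.1.
  have := block_side hY sepc; rewrite /ord cint => /(_ (iX _ wX)).
  case: (Y \subset c.1) => //= /subsetP/(_ w wY).
  by rewrite in_setC comp_self.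
have Xm : X \subset (meet s c).2 by apply: subset_trans Xs (subsetUl _ _).
have := eff _ (separation_meet seps sepc).
rewrite subsetI Ys Yc => /(_ isT Xm) le.
have sub : (meet s c).1 :&: (meet s c).2 \subset s.1 :&: s.2 :&: c.1.
  apply/subsetP=> z; case/setIP=> /setIP[z1 zc1];
    rewrite [_ \in s.1 :&: s.2 :&: c.1]in_setI in_setI zc1 z1.
  case/setUP=> [->|zc2] //.
  have : z \in c.1 :&: c.2 by rewrite in_setI zc1.
  by rewrite cint => /(subsetP (nbhd_sub _ _))/(subsetP Xs) ->.
have {}le : ord s <= #|s.1 :&: s.2 :&: c.1| := leq_trans le (subset_leq_card sub).
have eq : s.1 :&: s.2 :&: c.1 = s.1 :&: s.2.
  by apply/eqP; rewrite eqEcard subsetIl.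
have subc : s.1 :&: s.2 \subset c.1 by rewrite -eq subsetIr.
(* [x] is in the separator but not in [X], so it lies in the component of [w], which is therefore
   that of [v]. *)
have xc := subsetP subc x xs; rewrite in_setU in xc.
have xX := comp_out vX xv.
have xw : x \in component X w.
  by case/orP: xc => // /(subsetP (nbhd_sub _ _)); rewrite (negPf xX).
by rewrite (comp_eq xv xw).
Qed.

Lemma maximal_separator X s v : kblock k X -> isolable X -> s \in maximal_towards X ->
  v \notin X -> s.1 :&: s.2 :&: component X v != set0 ->
  s.1 :&: s.2 \subset component X v :|: nbhd X (component X v).
Proof.
move=> hX iX sM; have [Y [hY YX e]] := maximal_efficient hX sM.
exact: efficient_separator e.
Qed.

(** Comparable ones coincide by maximality, and [swap s] below [r] would put [X] into [r.1]. *)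
Lemma maximal_pair X s r : kblock k X -> s \in maximal_towards X ->
  r \in maximal_towards X -> s != r -> sle s (swap r).
Proof.
move=> hX /maximal_towardsP[sN Xs st smax] /maximal_towardsP[rN Xr rt rmax] sr.
case/or4P: (block_seps_nested sN rN) => // h.
- by rewrite (smax _ rt h) eqxx in sr.
- case/andP: h => h _; have := towards_not_fst hX rt.
  by rewrite (subset_trans Xs h).
- by rewrite sle_swap in h; rewrite (rmax _ st h) eqxx in sr.
Qed.

(** * The isolating separation of a single component *)

Section Branch.
Variables (X : {set G}) (v : G).
Hypotheses (hX : kblock k X) (iX : isolable X) (cv : central X v).
Let C := component X v.
Let vX : v \notin X. Proof. by case/andP: cv. Qed.

Lemma branchP u : reflect (u \in C \/
    exists s, [/\ s \in maximal_towards X, s.1 :&: s.2 :&: C != set0,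
      u \in s.1 & u \notin s.2])
  (u \in branch X C).
Proof.
rewrite in_setU; apply: (iffP orP) => -[->|]; try by left.
  by case/bigcupP=> s /andP[sM m] /setDP[u1 u2]; right; exists s.
case=> s [sM m u1 u2]; right; apply/bigcupP; exists s; rewrite ?sM //.
by rewrite inE u2.
Qed.

Lemma branch_out u : u \in branch X C -> u \notin X.
Proof.
case/branchP=> [|[s [sM _ _ us]]]; first exact: comp_out.
by have [_ /subsetP Xs _ _] := maximal_towardsP sM; apply: contra us; exact: Xs.
Qed.

Lemma branch_self : v \in branch X C.
Proof. by apply/branchP; left; exact: comp_self. Qed.

Lemma isolating_subset : X \subset (isolating X C).2.
Proof.
by apply/subsetP=> x xX; rewrite in_setC; apply/negP=> /branch_out; rewrite xX.
Qed.

(** An edge leaving the branch from [C] ends in [nbhd X C]. One leaving it from an absorbed side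
    [s.1 :\: s.2] ends in the separator of [s], which by [maximal_separator] lies in [C] and
    [nbhd X C], hence again in the latter. *)
Lemma isolating_separation : separation (isolating X C).
Proof.
apply/separationP; split=> /= [|x|u w].
- by apply/setP=> x; rewrite in_setU in_setC in_setU in_setT; case: (x \in branch X C);
  rewrite ?orbT.
- by rewrite in_setU negb_or in_setC => /andP[].
rewrite in_setC negbK in_setU negb_or => /branchP uU /andP[wU wn]; apply/negP=> uw.
case: uU => [uC|[s [sM m u1 u2]]].
  have wX : w \in X.
    apply: contraNT wU => wX; apply/branchP; left; exact: comp_step uC uw wX.
  by move: wn; rewrite inE wX /= => /exists_inP[]; exists u.
have [sN _ _ _] := maximal_towardsP sM.
have [_ _ h] := separationP _ (block_sep_sep sN).
have w1 : w \in s.1 by apply: contraLR uw => w1; apply: h.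
have w2 : w \in s.2.
  by apply: contraNT wU => w2; apply/branchP; right; exists s.
have := subsetP (maximal_separator hX iX sM vX m) w; rewrite in_setI w1 w2 => /(_ isT).
rewrite in_setU (negPf wn) orbF => wC.
by case/branchP: wU; left.
Qed.

Lemma isolating_ord : ord (isolating X C) < k.
Proof.
apply: leq_ltn_trans (isolableP _ iX v vX); apply: subset_leq_card.
apply/subsetP=> x; rewrite in_setI in_setU in_setC => /andP[/orP[->|->] //].
Qed.

Lemma isolating_regular : ~~ sle (isolating X C) (swap (isolating X C)).
Proof.
apply/negP=> /andP[/subsetP h _]; have := h v.
by rewrite /= in_setU in_setC branch_self => /(_ isT).
Qed.

Lemma isolating_swap_regular : ~~ sle (swap (isolating X C)) (isolating X C).
Proof.
apply/negP=> /andP[h _].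
have := block_side hX isolating_separation isolating_ord.
by rewrite isolating_subset (subset_trans isolating_subset h).
Qed.

Lemma maximal_avoid s u : s \in maximal_towards X -> s.1 :&: s.2 :&: C = set0 ->
  u \in C -> u \notin s.1.
Proof.
move=> sM m; have [sN _ st _] := maximal_towardsP sM.
apply: (comp_avoid (block_sep_sep sN) vX m (comp_self X v)).
by case/andP: cv => _ /forall_inP; apply.
Qed.

(** It suffices to treat a maximal separation [r]. If its separator meets [C], its far side has been
    absorbed; if not, the branch avoids [r.1]: the component by [maximal_avoid], the absorbed sides
    by [maximal_pair]. *)
Lemma isolating_towards s : s \in towards X ->
  sle s (isolating X C) || sle s (swap (isolating X C)).
Proof.
move=> /towards_max[r rM sr].
suff : sle r (isolating X C) || sle r (swap (isolating X C)).
  by case/orP=> h; rewrite (sle_trans sr h) ?orbT.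
have [rN Xr rt rmax] := maximal_towardsP rM.
have [_ cov _] := separationP _ (block_sep_sep rN).
have [m|m] := boolP (r.1 :&: r.2 :&: C == set0); last first.
  have rU u : u \in r.1 -> u \notin r.2 -> u \in branch X C.
    by move=> u1 u2; apply/branchP; right; exists r.
  apply/orP; left; apply/andP; split; apply/subsetP=> u /=; last first.
    rewrite in_setC; apply: contraNT => u2; apply: rU => //.
    by apply: contraNT u2; exact: cov.
  move=> u1; case u2: (u \in r.2); last by rewrite in_setU rU ?u2.
  have := subsetP (maximal_separator hX iX rM vX m) u;
    rewrite in_setI u1 u2 => /(_ isT).
  case/setUP=> [uC|un]; apply/setUP; last by right.
  by left; apply/branchP; left.
have avoid u : u \in branch X C -> u \notin r.1.
  case/branchP=> [|[t [tM mt _ u2]]]; first by apply: maximal_avoid => //; apply/eqP.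
  have rt' : r != t by apply: contraNneq mt => <-.
  case/andP: (maximal_pair hX rM tM rt') => /subsetP h _.
  by apply: contra u2; apply: h.
apply/orP; right; apply/andP; split; apply/subsetP=> u /=.
  by rewrite in_setC; apply: contraL; exact: avoid.
rewrite in_setU => /orP[/avoid/cov //|/(subsetP (nbhd_sub _ _))]; exact: (subsetP Xr).
Qed.

End Branch.

Lemma meet_comp X v w s : kblock k X -> isolable X -> s \in maximal_towards X ->
  v \notin X -> w \notin X ->
  s.1 :&: s.2 :&: component X v != set0 -> s.1 :&: s.2 :&: component X w != set0 ->
  component X v = component X w.
Proof.
move=> hX iX sM vX wX mv /set0Pn[x /setIP[xs xw]].
have := subsetP (maximal_separator hX iX sM vX mv) x xs.
case/setUP=> [xv|/(subsetP (nbhd_sub _ _))]; first exact: comp_eq xv xw.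
by rewrite (negPf (comp_out wX xw)).
Qed.

(** An absorbed side meets the component of a central vertex only if its separator does, distinct
    absorbed sides are disjoint, and by [meet_comp] one separator meets at most one component. *)
Lemma branch_disjoint X v w u : kblock k X -> isolable X -> central X v ->
  central X w ->
  u \in branch X (component X v) -> u \in branch X (component X w) ->
    component X v = component X w.
Proof.
move=> hX iX cv cw; have [vX _] := andP cv; have [wX _] := andP cw.
have half v' w' s : central X v' -> central X w' -> u \in component X v' ->
    s \in maximal_towards X -> s.1 :&: s.2 :&: component X w' != set0 -> u \in s.1 ->
    component X v' = component X w'.
  move=> cv' cw' uv sM mw us;
    have [m|m] := boolP (s.1 :&: s.2 :&: component X v' == set0).
    by have := maximal_avoid cv' sM (eqP m) uv; rewrite us.
  by apply: meet_comp m mw => //; [case/andP: cv'|case/andP: cw'].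
move=> /branchP[uv|[s [sM ms us1 us2]]] /branchP[uw|[r [rM mr ur1 ur2]]].
- exact: comp_eq uv uw.
- exact: half mr ur1.
- by apply/esym; exact: half ms us1.
have [e|sr] := eqVneq s r.
  by apply: (meet_comp hX iX rM) => //; rewrite -e.
case/andP: (maximal_pair hX sM rM sr) => /subsetP/(_ u us1) /= h _.
by rewrite h in ur2.
Qed.

Lemma isolating_nested X v w : kblock k X -> isolable X -> central X v -> central X w ->
  nested (isolating X (component X v)) (isolating X (component X w)).
Proof.
move=> hX iX cv cw; have [->|ne] := eqVneq (component X v) (component X w).
  by rewrite /nested sle_refl.
have disj u : u \in branch X (component X v) -> u \notin branch X (component X w).
  move=> uv; apply: contra ne => uw; apply/eqP; exact: branch_disjoint uv uw.
have vX : v \notin X by case/andP: cv.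
have wX : w \notin X by case/andP: cw.
rewrite /nested; apply/orP; right; apply/orP; left.
apply/andP; split; apply/subsetP=> u /setUP[ub|un] /=; rewrite in_setC.
- exact: disj.
- by apply/negP=> /(branch_out cw); rewrite (subsetP (nbhd_sub _ _) _ un).
- by apply/negP=> /disj; rewrite ub.
- by apply/negP=> /(branch_out cv); rewrite (subsetP (nbhd_sub _ _) _ un).
Qed.

Lemma isolatorsP s : reflect
  (exists X v, [/\ kblock k X, isolable X, central X v
     & s = isolating X (component X v) \/ s = swap (isolating X (component X v))])
  (s \in isolators).
Proof.
rewrite in_set; apply: (iffP existsP) => -[X].
  by case/existsP=> v /and4P[a b c /orP[]/eqP->]; exists X, v; split=> //; [left|right].
case=> v [a b c d]; exists X; apply/existsP; exists v; rewrite a b c /=.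
by case: d => ->; rewrite eqxx ?orbT.
Qed.

(** * The enlarged nested set and its tree-decomposition *)

Definition isolated_seps := N0 :|: isolators.
Local Notation N1 := isolated_seps.

Lemma isolated_seps_swap s : s \in N1 -> swap s \in N1.
Proof.
case/setUP=> [/block_seps_swap h|/isolatorsP[X [v [a b c d]]]]; apply/setUP;
  first by left.
right; apply/isolatorsP; exists X, v; split=> //.
by case: d => ->; rewrite ?swapK; [right|left].
Qed.

Lemma isolated_seps_sep s : s \in N1 -> separation s.
Proof.
case/setUP=> [/block_sep_sep //|/isolatorsP[X [v [a b c [] ->]]]].
  exact: isolating_separation.
by apply: separation_swap; exact: isolating_separation.
Qed.

Lemma isolated_seps_ord s : s \in N1 -> ord s < k.
Proof.
case/setUP=> [/block_sep_ord //|/isolatorsP[X [v [a b c [] ->]]]]; rewrite ?ord_swap;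
  exact: isolating_ord.
Qed.

Lemma isolated_seps_regular s : s \in N1 -> ~~ sle s (swap s).
Proof.
case/setUP=> [/block_sep_regular //|/isolatorsP[X [v [a b c [] ->]]]].
  exact: isolating_regular.
by rewrite swapK; exact: isolating_swap_regular.
Qed.

(** [t] keeps [s] and [r] apart: in the basic case [swap r] is below [t] and [t] below [s]; the rest
    follows by swapping. *)
Lemma nested_opposite s r t : sle t s || sle t (swap s) ->
  sle (swap t) r || sle (swap t) (swap r) -> nested s r.
Proof.
have key s' r' : sle t s' -> sle (swap t) r' -> nested s' r'.
  move=> h1; rewrite sle_swapl => h2.
  by rewrite nested_sym -nested_swapl /nested (sle_trans h2 h1).
case/orP=> h1 /orP[] h2; have h := key _ _ h1 h2.
- by [].
- by rewrite -nested_swapr.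
- by rewrite -nested_swapl.
- by rewrite -nested_swapl -nested_swapr.
Qed.

Lemma isolating_block_nested X v s : kblock k X -> isolable X -> central X v ->
  s \in N0 ->
  nested s (isolating X (component X v)).
Proof.
move=> hX iX cv.
wlog sX : s / X \subset s.2.
  move=> W sN; have [sX|sX] := boolP (X \subset s.2); first exact: W.
  rewrite -nested_swapl; apply: W; last exact: block_seps_swap.
  by move: sX; rewrite (block_sep_side hX) // negbK.
move=> sN; have st : s \in towards X by apply/setIdP.
by case/orP: (isolating_towards hX iX cv st) => h; rewrite /nested h ?orbT.
Qed.

Lemma isolating_nested2 X Y v w : kblock k X -> isolable X -> central X v ->
  kblock k Y -> isolable Y -> central Y w ->
  nested (isolating X (component X v)) (isolating Y (component Y w)).
Proof.
move=> hX iX cv hY iY cw; have [e|XY] := eqVneq X Y.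
  by rewrite -e in hY iY cw *; apply: isolating_nested.
(* An optimal separation of the two blocks points towards [Y] and its swap towards [X], so
   [isolating_towards] applies on either side of it. *)
have [s os] := optimal_exists hX hY XY.
have [es _] := andP os; have /efficientP[_ Xs Ys _] := es.
have sN : s \in N0 by apply/block_sepsP; exists X, Y.
apply: (@nested_opposite _ _ (swap s)).
  by apply: isolating_towards => //; apply/setIdP; split; first exact: block_seps_swap.
by rewrite swapK; apply: isolating_towards => //; apply/setIdP.
Qed.

Lemma isolated_seps_nested s r : s \in N1 -> r \in N1 -> nested s r.
Proof.
case/setUP=> [sN|/isolatorsP[X [v [a b c d]]]];
  case/setUP=> [rN|/isolatorsP[Y [w [a' b' c' d']]]].
- exact: block_seps_nested sN rN.
- by case: d' => ->; rewrite ?nested_swapr isolating_block_nested.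
- by rewrite nested_sym; case: d => ->; rewrite ?nested_swapr isolating_block_nested.
- by case: d => ->; case: d' => ->;
  rewrite ?nested_swapl ?nested_swapr isolating_nested2.
Qed.

Local Notation T := (nested_tree isolated_seps_swap isolated_seps_regular).
Local Notation V := (@part _ _ isolated_seps_swap isolated_seps_regular).

Lemma isolated_seps_cover s : s \in N1 -> s.1 :|: s.2 = setT.
Proof. by move/isolated_seps_sep/separationP => []. Qed.

Lemma block_orientation X : kblock k X -> orientation N1 [set s in N1 | X \subset s.2].
Proof.
move=> hX; have mem t : (t \in [set s in N1 | X \subset s.2]) = (t \in N1) && (X
  \subset t.2).
  exact: in_set.
apply/orientationP; split=> [s|s sN|s r sN]; first by case/setIdP.
  rewrite !mem sN isolated_seps_swap //=.
  by rewrite (block_side hX) ?isolated_seps_sep ?isolated_seps_ord ?negbK.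
case/setIdP=> rN Xr /andP[_ rs]; apply/setIdP; split=> //.
exact: subset_trans Xr rs.
Qed.

Definition block_node X (hX : kblock k X) : T := Sub _ (block_orientation hX).

Lemma mem_block_node X (hX : kblock k X) s :
  (s \in val (block_node hX)) = (s \in N1) && (X \subset s.2).
Proof. by rewrite SubK in_set. Qed.

Lemma block_part X (hX : kblock k X) : X \subset V (block_node hX).
Proof. by apply/bigcapsP=> s; rewrite mem_block_node => /andP[]. Qed.

(** A further vertex [v] in the part at the node of [X] would be central; but the isolating
    separation of its component points towards [X] and excludes [v]. *)
Lemma isolable_part X : kblock k X -> isolable X -> is_part V X.
Proof.
move=> hX iX; exists (block_node hX); apply/eqP; rewrite eqEsubset block_part andbT.
apply/subsetP=> v /partP vX; apply/negPn/negP => nvX.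
have cv : central X v.
  rewrite /central nvX; apply/forall_inP=> s /setIdP[sN Xs].
  by apply: vX; rewrite mem_block_node Xs in_setU sN.
have := vX (isolating X (component X v));
  rewrite mem_block_node isolating_subset // andbT.
rewrite /= in_setC branch_self => h.
suff /h : isolating X (component X v) \in N1 by [].
by apply/setUP; right; apply/isolatorsP; exists X, v; split=> //; left.
Qed.

Lemma isolated_tree_decomposition : tree_decomposition V.
Proof.
have nes := isolated_seps_nested.
split.
- exact: nested_tree_is_tree.
- move=> x; have [|t xt] := @exists_part _ _ isolated_seps_swap nes
  isolated_seps_regular [set x].
    move=> s sN; rewrite !sub1set; have := isolated_seps_cover sN.
    by move/setP/(_ x); rewrite !inE.
  by exists t; rewrite -sub1set.
- move=> x y xy; have [|t xt] :=
  @exists_part _ _ isolated_seps_swap nes isolated_seps_regular [set x; y].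
    move=> s sN; rewrite !subUset !sub1set.
    have /separationP[_ cov h] := isolated_seps_sep sN.
    case x1: (x \in s.1); case y1: (y \in s.1) => //=.
    + rewrite [y \in s.2]cov ?y1 // andbT; apply: contraLR xy => x2.
      by apply: h; rewrite ?y1.
    + rewrite [x \in s.2]cov ?x1 //=; apply: contraLR xy => y2.
      by rewrite adj_sym; apply: h; rewrite ?x1.
    + by rewrite !cov ?x1 ?y1.
  by exists t; move: xt; rewrite subUset !sub1set.
- by move=> t1 t2 p; exact: part_path.
Qed.

Lemma isolated_adhesion : adhesion_lt V k.
Proof.
move=> t t' /exists_inP[s sN /andP[/eqP e1 /eqP e2]].
by rewrite (part_adj sN e1 e2 (isolated_seps_cover sN)); apply: isolated_seps_ord.
Qed.

Lemma isolated_distinguishes : distinguishes_efficiently V k.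
Proof.
move=> X Y hX hY XY; have [s os] := optimal_exists hX hY XY.
have [es _] := andP os; have /efficientP[seps Xs Ys eff] := es.
have s0 : s \in N0 by apply/block_sepsP; exists X, Y.
have sN : s \in N1 by apply/setUP; left.
have sN' := isolated_seps_swap sN.
have nes := isolated_seps_nested.
have ou r : r \in N1 -> orientation N1 (up N1 r).
  by move=> rN; exact: (up_orientation isolated_seps_swap nes isolated_seps_regular).
(* [X] lies in [s.1], so the end of the edge on its side is the node that contains [swap s]. *)
pose t : T := Sub _ (ou _ sN'); pose t' : T := Sub _ (ou _ sN).
have et : val t = up N1 (swap s) by [].
have et' : val t' = up N1 (swap (swap s)) by rewrite swapK.
have eV : V t :&: V t' = s.1 :&: s.2.
  by rewrite (part_adj sN' et et' (isolated_seps_cover sN')) setIC.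
exists t, t'; split.
- by apply/exists_inP; exists (swap s); rewrite // et et' !eqxx.
- split; first by rewrite eV; exact: separation_separates.
  exists (block_node hX), (block_node hY); split; try exact: block_part.
    by apply: (mem_side nes sN' et et'); rewrite mem_block_node sN'.
  by apply: (mem_side nes sN _ _); rewrite ?mem_block_node ?sN.
- by move=> S /separates_separation[r [sepr <- Xr Yr]]; rewrite eV; apply: eff.
Qed.

End Isolation.

(** * Equivariance *)

Section Equivariance.
Variables (G : sgraph) (k : nat).
Local Notation sep := ({set G} * {set G})%type.
Implicit Types (s r : sep) (X Y C : {set G}) (a : {perm G}).

Lemma automorphismV a : automorphism a -> automorphism (a^-1)%g.
Proof. by move=> ha x y; rewrite -[in RHS](permKV a x) -[in RHS](permKV a y) ha. Qed.

Lemma mem_image a x X : (a x \in a @: X) = (x \in X).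
Proof. by rewrite mem_imset //; exact: perm_inj. Qed.

Lemma imageKV a X : a @: ((a^-1)%g @: X) = X.
Proof.
apply/setP=> x; rewrite -[x](permKV a) mem_image mem_imset //; last exact: perm_inj.
by rewrite permKV.
Qed.

Lemma imageK a X : (a^-1)%g @: (a @: X) = X.
Proof. by have := imageKV (a^-1)%g X; rewrite invgK. Qed.

Lemma image_sepKV a s : image_sep a (image_sep (a^-1)%g s) = s.
Proof. by case: s => A B; rewrite /image_sep /= !imageKV. Qed.

Lemma image_separation a s : automorphism a -> separation s ->
  separation (image_sep a s).
Proof.
move=> ha /separationP[c cov h].
apply/separationP; split=> [|x|u v] /=.
- by apply/setP=> x; rewrite -[x](permKV a) in_setU !mem_image -in_setU c !in_setT.
- by rewrite -[x](permKV a) !mem_image; exact: cov.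
- by rewrite -[u](permKV a) -[v](permKV a) !mem_image ha; exact: h.
Qed.

Lemma image_separates a S X Y : automorphism a -> separates S X Y ->
  separates (a @: S) (a @: X) (a @: Y).
Proof.
move=> ha /separates_separation[s [hs <- Xs Ys]].
rewrite imsetI; last by move=> x y _ _; exact: perm_inj.
by apply: (separation_separates (image_separation ha hs)); rewrite image_subset.
Qed.

Lemma image_inseparable a X : automorphism a -> inseparable k X ->
  inseparable k (a @: X).
Proof.
move=> ha /forall_inP iX; apply/forall_inP=> _ /imsetP[x xX ->].
apply/forall_inP=> _ /imsetP[y yX ->]; apply/implyP=> xy;
  apply/forall_inP=> S /and3P[Sk xS yS].
have xy' : x != y by apply: contraNneq xy => ->.
have := implyP (forall_inP (iX x xX) y yX) xy' => /forall_inP/(_ ((a^-1)%g @: S)).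
rewrite card_imset; last exact: perm_inj.
have memV z : (z \in (a^-1)%g @: S) = (a z \in S) by rewrite -[in RHS](mem_image
  (a^-1)%g) permK.
rewrite Sk !memV xS yS => /(_ isT).
apply: contra => /(image_separates (automorphismV ha)).
by rewrite !imset_set1 !permK.
Qed.

Lemma image_kblock a X : automorphism a -> kblock k X -> kblock k (a @: X).
Proof.
move=> ha /kblockP[Xk iX mX]; apply/maxsetP; split=> /= [|Y].
  by rewrite card_imset ?Xk ?image_inseparable //; exact: perm_inj.
case/andP=> Yk iY XY; rewrite -(mX ((a^-1)%g @: Y)) ?imageKV //.
- by rewrite card_imset //; exact: perm_inj.
- exact: image_inseparable (automorphismV ha) iY.
- by rewrite -(imageK a X) image_subset.
Qed.

Lemma image_efficient a X Y s : automorphism a -> efficient X Y s ->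
  efficient (a @: X) (a @: Y) (image_sep a s).
Proof.
move=> ha /efficientP[hs Xs Ys eff]; apply/efficientP; split.
- exact: image_separation.
- by rewrite image_subset.
- by rewrite image_subset.
move=> r hr Xr Yr; rewrite image_ord -[ord r](image_ord (a^-1)%g); apply: eff.
- exact: image_separation (automorphismV ha) hr.
- by rewrite -(imageK a X) image_subset.
- by rewrite -(imageK a Y) image_subset.
Qed.

Lemma image_neq a X Y : X != Y -> a @: X != a @: Y.
Proof. by apply: contraNneq => /(imset_inj (@perm_inj _ a)) ->. Qed.

Lemma image_distinguishers a s : automorphism a ->
  s \in distinguishers G k -> image_sep a s \in distinguishers G k.
Proof.
move=> ha; rewrite inE => /existsP[X /existsP[Y /and4P[hX hY XY e]]].
apply: (mem_distinguishers (image_kblock ha hX) (image_kblock ha hY)).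
  exact: image_neq.
exact: image_efficient.
Qed.

Lemma image_crossings a s : automorphism a ->
  crossings (distinguishers G k) (image_sep a s) = crossings (distinguishers G k) s.
Proof.
move=> ha; rewrite /crossings -[RHS](card_imset _ (@image_sep_inj _ a)).
apply: eq_card => r; rewrite -[r](image_sepKV a).
rewrite (mem_imset _ _ (@image_sep_inj _ a)) ![_ \in [set _ in _ | _]]in_set
  image_nested.
by rewrite image_sep_mem // => t; exact: image_distinguishers.
Qed.

Lemma image_optimal a X Y s : automorphism a -> optimal k X Y s ->
  optimal k (a @: X) (a @: Y) (image_sep a s).
Proof.
move=> ha /andP[e /forall_inP m]; rewrite /optimal image_efficient //.
apply/forall_inP=> r er; rewrite image_crossings // -(image_crossings r (automorphismV
  ha)).
by apply: m; rewrite -(imageK a X) -(imageK a Y); apply: image_efficient => //;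
  exact: automorphismV.
Qed.

Lemma image_block_seps a s : automorphism a ->
  (image_sep a s \in block_seps G k) = (s \in block_seps G k).
Proof.
move=> ha; apply: image_sep_mem => {}s /block_sepsP[X [Y [hX hY XY os]]].
apply/block_sepsP; exists (a @: X), (a @: Y).
by split; [exact: image_kblock|exact: image_kblock|exact: image_neq|exact:
  image_optimal].
Qed.

Lemma image_towards a X s : automorphism a ->
  (image_sep a s \in towards k (a @: X)) = (s \in towards k X).
Proof. by move=> ha; rewrite ![_ \in towards _ _]in_set image_block_seps //
  image_subset. Qed.

Lemma image_maximal_towards a X s : automorphism a ->
  (image_sep a s \in maximal_towards k (a @: X)) = (s \in maximal_towards k X).
Proof.
move=> ha; rewrite ![_ \in maximal_towards _ _]in_set image_towards //; congr (_ && _).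
apply/forall_inP/forall_inP => h r rt; apply/implyP=> sr.
  have := h (image_sep a r); rewrite image_towards // image_sle sr => /(_ rt) /eqP e.
  by rewrite (image_sep_inj e).
move: rt sr; rewrite -[r](image_sepKV a) image_towards // image_sle => rt sr.
by have := h _ rt; rewrite sr => /eqP->.
Qed.

Lemma image_comp a X v : automorphism a ->
  component (a @: X) (a v) = a @: component X v.
Proof.
move=> ha.
(* This inclusion, stated for every automorphism, gives the reverse one through the inverse. *)
have sub b X' v' : automorphism b ->
  b @: component X' v' \subset component (b @: X') (b v').
  move=> hb; apply/subsetP=> _ /imsetP[u + ->]; rewrite !inE => /connectP[p].
  elim: p v' => [|w p IH] v' /=; first by move=> _ ->; exact: connect0.
  case/andP=> /and3P[vw vX wX] pw e.
  apply: connect_trans (connect1 _) (IH w pw e).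
  by apply/and3P; rewrite hb !mem_image.
apply/eqP; rewrite eqEsubset sub // andbT.
rewrite -[component _ (a v)](imageKV a) image_subset.
by apply: subset_trans (sub _ _ _ (automorphismV ha)) _; rewrite imageK permK.
Qed.

Lemma image_nbhd a X C : automorphism a -> nbhd (a @: X) (a @: C) = a @: nbhd X C.
Proof.
move=> ha; apply/setP=> x; rewrite -[x](permKV a) mem_image !in_set mem_image;
  congr (_ && _).
apply/exists_inP/exists_inP => -[u uC ux].
  exists ((a^-1)%g u); first by rewrite -(mem_image a) permKV.
  by rewrite -ha permKV.
by exists (a u); rewrite ?mem_image ?ha.
Qed.

Lemma image_branch a X C : automorphism a ->
  branch k (a @: X) (a @: C) = a @: branch k X C.
Proof.
move=> ha; rewrite /branch imsetU; congr (_ :|: _).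
have iD s : (image_sep a s).1 :\: (image_sep a s).2 = a @: (s.1 :\: s.2).
  by apply/setP=> x; rewrite -[x](permKV a) mem_image !inE !mem_image.
have iI s : ((image_sep a s).1 :&: (image_sep a s).2 :&: a @: C != set0) =
    (s.1 :&: s.2 :&: C != set0).
  rewrite -[in RHS]card_gt0 -(card_imset _ (@perm_inj _ a)) card_gt0; congr (_ != _).
  by apply/setP=> x; rewrite -[x](permKV a) mem_image !inE !mem_image.
apply/setP=> x; rewrite -[x](permKV a) mem_image.
apply/bigcupP/bigcupP => -[s].
  rewrite -[s](image_sepKV a) image_maximal_towards // iI iD mem_image => h1 h2.
  by exists (image_sep (a^-1)%g s).
by move=> h1 h2; exists (image_sep a s);
  rewrite ?image_maximal_towards ?iI ?iD ?mem_image.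
Qed.

Lemma image_isolating a X C : automorphism a ->
  image_sep a (isolating k X C) = isolating k (a @: X) (a @: C).
Proof.
move=> ha; rewrite /isolating image_branch // image_nbhd // /image_sep /= imsetU;
  congr (_, _).
by apply/setP=> x; rewrite -[x](permKV a) mem_image !in_setC mem_image.
Qed.

Lemma image_isolable a X : automorphism a -> isolable k X -> isolable k (a @: X).
Proof.
move=> ha /isolableP iX; apply/isolableP=> v; rewrite -[v](permKV a) mem_image => vX.
by rewrite image_comp // image_nbhd // card_imset ?iX //; exact: perm_inj.
Qed.

Lemma image_central a X v : automorphism a -> central k X v -> central k (a @: X) (a v).
Proof.
move=> ha /andP[vX /forall_inP h]; rewrite /central mem_image vX.
apply/forall_inP=> s; rewrite -[s](image_sepKV a) image_towards // => st.
by rewrite mem_image h.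
Qed.

Lemma image_isolated_seps a s : automorphism a ->
  s \in isolated_seps G k -> image_sep a s \in isolated_seps G k.
Proof.
move=> ha /setUP[sN|/isolatorsP[X [v [hX iX cv d]]]]; apply/setUP.
  by left; rewrite image_block_seps.
right; apply/isolatorsP; exists (a @: X), (a v); split.
- exact: image_kblock.
- exact: image_isolable.
- exact: image_central.
- by rewrite image_comp // -image_isolating //; case: d => ->; [left|right].
Qed.

End Equivariance.

(** * Parts of tree-decompositions of small adhesion *)

(** With [X = W t0], a component of [G - X] lives in parts within one component of [T - t0]. The
    latter contains only one neighbour [t] of [t0], and all neighbours of the graph component lie in
    the adhesion set [W t0 :&: W t]. *)
Lemma part_isolable (k : nat) (k_ge1 : 0 < k) (G T : sgraph) (W : T -> {set G}) X :
  tree_decomposition W -> adhesion_lt W k -> is_part W X -> isolable k X.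
Proof.
case=> -[_ Tconn Tacyc] Wcov Wadj Wpath Wk [t0 eX].
apply/isolableP=> v vX.
pose R := adj_minus [set t0].
have notX t u : u \notin X -> u \in W t -> t != t0.
  by move=> uX ut; apply: contraNneq uX => e; rewrite -eX -e.
(* The tree path between two parts containing [u] consists of parts containing [u], so it avoids
   [t0]. *)
have same u s s' : u \notin X -> u \in W s -> u \in W s' -> connect R s s'.
  move=> uX us us'; have /connectP[p pth e] := Tconn s s'.
  case/shortenP: pth e => q pq uq _ e.
  have all_u t : t \in s :: q -> u \in W t.
    move=> tq; apply: (subsetP (Wpath s t q pq uq tq)); rewrite -e inE us; exact: us'.
  have : {subset s :: q <= [pred t | t != t0]} by move=> t /all_u; apply: notX.
  move: pq e {uq all_u us us'}; elim: q s => [|t q IH] s /=; first by move=> _ ->.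
  case/andP=> st pq e h; apply: connect_trans (connect1 _) (IH t pq e _).
    have hs : s != t0 by apply: h; exact: mem_head.
    have ht : t != t0 by apply: h; rewrite !inE eqxx orbT.
    by apply/and3P; rewrite !in_set1.
  by move=> z zq; apply: h; rewrite inE zq orbT.
have [t1 vt1] := Wcov v.
have reach u s : u \in component X v -> u \in W s -> connect R t1 s.
  rewrite inE => /connectP[p]; elim: p v vX t1 vt1 => [|w p IH] v' v'X t v't /=.
    by move=> _ -> us; exact: same us.
  case/andP=> /and3P[vw _ wX] pw e us; have [t' /andP[vt' wt']] := Wadj _ _ vw.
  by apply: connect_trans (same v' _ _ _ v't vt') (IH w wX t' wt' pw e us).
(* Candidates for the tree neighbour of [t0] towards the component; two of them would close a cycle
   through [t0]. *)
pose K t := connect R t1 t && adj t0 t.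
have K1 t t' : K t -> K t' -> t = t'.
  case/andP=> c1 a1 /andP[c2 a2]; apply/eqP/negPn/negP => tt'.
  have : connect R t t'.
    by apply: connect_trans c2; rewrite adj_minus_sym.
  case/connectP=> p pth e; case/shortenP: pth e => q pq uq _ e.
  have pq' : path (@adj T) t q by apply: sub_path pq => x y /and3P[].
  have nt0 : t0 \notin t :: q.
    have : t != t0 by apply: contraTneq a1 => ->; rewrite adj_irrefl.
    clear -pq; elim: q t pq => [|z q IH] t /=; first by rewrite inE eq_sym.
    by case/andP=> /and3P[_ _ zt] /IH h tt; rewrite inE negb_or eq_sym tt h // -in_set1.
  have := Tacyc (t0 :: t :: q); rewrite /ucycle /= rcons_path pq' a1 -e adj_sym a2 /=.
  rewrite -/(uniq (t :: q)) uq nt0 /=.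
  by case: q e {pq uq pq' nt0} => [/= e|z q _ /(_ isT)] //; rewrite e eqxx in tt'.
(* [x] lies in [W t0] and in a part on the side of the component, hence in the first part after [t0]
   on the path between them. *)
have attach x : x \in nbhd X (component X v) -> exists2 t, K t & x \in W t.
  rewrite inE => /andP[xX /exists_inP[u uC ux]].
  have uX := comp_out vX uC.
  have [s /andP[us xs]] := Wadj _ _ ux.
  have st0 := notX _ _ uX us.
  have /connectP[p pth e] := Tconn t0 s.
  case/shortenP: pth e => q pq uq _ e.
  case: q pq uq e => [_ _ /= e|t q]; first by rewrite e eqxx in st0.
  case/andP=> t0t pq uq /= e.
  have xt : x \in W t.
    apply: (subsetP (Wpath t0 t (t :: q) _ uq _)); rewrite /= ?t0t //.
      by rewrite !inE eqxx orbT.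
    by rewrite -e inE eX xX.
  exists t => //; apply/andP; split=> //.
  apply: connect_trans (reach _ _ uC us) _.
  rewrite adj_minus_sym; apply/connectP; exists q => //.
  have nt0 : t0 \notin t :: q by case/andP: uq.
  clear -pq nt0; elim: q t pq nt0 => //= z q IH t /andP[tz pq] nt0.
  have := nt0; rewrite !inE !negb_or => /and3P[h1 h2 h3].
  rewrite IH ?inE ?negb_or ?h2 // andbT; apply/and3P; rewrite !inE tz eq_sym h1 eq_sym.
  by rewrite h2.
(* Without neighbours there is no adhesion set to compare with; the bound is then [0 < k]. *)
have [N0|[x xN]] := set_0Vmem (nbhd X (component X v)); first by rewrite N0 cards0.
have [t Kt xt] := attach x xN; have /andP[_ t0t] := Kt.
apply: leq_ltn_trans (Wk _ _ t0t); apply: subset_leq_card.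
apply/subsetP=> y yN; have [t' Kt' yt'] := attach y yN.
by rewrite inE eX (subsetP (nbhd_sub _ _) _ yN) (K1 _ _ Kt Kt').
Qed.

Theorem corollary3p3 (k : nat) (k_ge1 : 1 <= k) (G : sgraph) :
  exists (T : sgraph) (V : T -> {set G}),
    good V k /\
    forall X : {set G}, kblock k X ->
      (exists (T' : sgraph) (W : T' -> {set G}),
        [/\ tree_decomposition W, adhesion_lt W k & is_part W X]) ->
      is_part V X.
Proof.
exists (nested_tree (@isolated_seps_swap G k) (@isolated_seps_regular G k)).
exists (@part _ _ (@isolated_seps_swap G k) (@isolated_seps_regular G k)); split.
  split.
  - exact: isolated_tree_decomposition.
  - move=> a ha; apply: canonical_nested_tree => s; exact: image_isolated_seps.
  - exact: isolated_adhesion.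
  - exact: isolated_distinguishes.
move=> X hX [T' [W [tdW adW pW]]]; apply: isolable_part => //.
exact: part_isolable pW.
Qed.
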